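(* Let the wallclock time of each of $P$ workers to process a single mini-batch be i.i.d. exponential random variables $X_1,X_2,\dots,X_P\sim\mathrm{Exp}(\mu)$ (rate $\mu$), and let $X$ denote a generic copy. Then the ratio of the expected runtimes per iteration for $K$-async (or $K$-sync) SGD and $K$-batch-async (or, respectively, $K$-batch-sync) SGD is $$\frac{\mathbb{E}[T_{K\text{-}async}]}{\mathbb{E}[T_{K\text{-}batch\text{-}async}]}=\frac{P\,\mathbb{E}[X_{K:P}]}{K\,\mathbb{E}[X]}\approx\frac{P\log\frac{P}{P-K}}{K},$$ where $X_{K:P}$ is the $K$-th order statistic ($K$-th smallest) of the i.i.d. random variables $X_1,\dots,X_P$.
   Context: A central parameter server (PS) interacts with $P$ parallel workers; $K\in\{1,\dots,P\}$. Times to compute the gradient of one mini-batch are i.i.d. across workers and mini-batches, and runtimes are measured by these computation times. An iteration is one update of the parameter at the PS; the expected runtime per iteration $\mathbb{E}[T]$ is the expected time between two consecutive updates. $K$-sync SGD: at each iteration all $P$ workers start one fresh mini-batch simultaneously; the PS updates when the first $K$ of them have finished, cancels the others, and all $P$ start afresh. $K$-batch-sync SGD: at each iteration all $P$ workers start afresh simultaneously; whenever a worker finishes a mini-batch it immediately starts another one (at the same parameter value); the PS updates when $K$ mini-batches in total have been finished, cancels the remaining computations, and all $P$ workers start afresh. $K$-async SGD: each worker computes on one mini-batch; the PS updates when $K$ of the $P$ workers have finished. These $K$ workers then start fresh mini-batches, while the other $P-K$ workers are not cancelled and continue. $K$-batch-async SGD: each worker starts a new mini-batch immediately after finishing (pushing)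 the previous one; every $K$ pushes in total, irrespective of which worker they come from, form one update. Its expected runtime per iteration is understood in the limit of a large number of iterations. The symbol $\approx$ is an informal approximation, with no limiting regime specified: it comes from $\mathbb{E}[X_{K:P}]=\sum_{i=P-K+1}^{P}\frac{1}{i\mu}\approx\frac{1}{\mu}\log\frac{P}{P-K}$, i.e. from replacing a difference of harmonic numbers by the corresponding difference of logarithms. *)

(* Defs.v *)
From HB Require Import structures.
From mathcomp Require Import all_boot all_order all_algebra.
From mathcomp Require Import all_classical all_reals all_analysis.

Set Implicit Arguments.
Unset Strict Implicit.
Unset Printing Implicit Defensive.

Import Order.TTheory GRing.Theory Num.Theory.
Import numFieldNormedType.Exports.

Local Open Scope classical_set_scope.
Local Open Scope ring_scope.

Definition mutually_independent d (T : measurableType d) (R : realType)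
    (Pr : probability T R) (I : eqType) (X : I -> {RV Pr >-> R}) : Prop :=
  forall (s : seq I) (A : I -> set R),
    uniq s -> (forall i, measurable (A i)) ->
    Pr (\bigcap_(i in [set` s]) (X i @^-1` A i)) =
    (\prod_(i <- s) Pr (X i @^-1` A i))%E.

(* The two set functions are compared on measurable sets only: the value of a
   measure outside its sigma-algebra is unspecified. *)
Definition exponential_rv d (T : measurableType d) (R : realType)
    (Pr : probability T R) (mu : R) (X : {RV Pr >-> R}) : Prop :=
  forall A : set R, measurable A ->
    distribution Pr X A = exponential_prob mu A.

Definition iid_exponential d (T : measurableType d) (R : realType)
    (Pr : probability T R) (mu : R) (I : eqType) (X : I -> {RV Pr >-> R}) :
    Prop :=
  mutually_independent X /\ forall i, exponential_rv mu (X i).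

Section Runtimes.
Variable R : realType.

(* k is counted from 1, so that k = 1 gives the minimum. *)
Definition kth_smallest (k : nat) (s : seq R) : R := nth 0 (sort <=%R s) k.-1.

Definition order_stat (P k : nat) (x : 'I_P -> R) : R :=
  kth_smallest k [seq x i | i <- enum 'I_P].

(* For computation times y i m of the m-th mini-batch (m = 0, 1, ...) of
   worker i, all workers starting at time 0 and computing without pause, the
   time at which n mini-batches in total have been finished.  The m-th
   mini-batch of worker i is finished at \sum_(j < m.+1) y i j; no worker
   contributes more than n of the first n finished mini-batches, so the n-th
   smallest of the finishing times with m < n is the n-th smallest of all.
   For n = 0 the list is empty and the value is 0. *)
Definition finish_time (P : nat) (y : 'I_P -> nat -> R) (n : nat) : R :=
  kth_smallest n
    [seq \sum_(j < m.+1) y i j | i <- enum 'I_P, m <- iota 0 n].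

(* Computation times are indexed as z r i m: the time worker i needs for the
   m-th mini-batch it starts since the r-th simultaneous start of all P workers
   (r, m = 0, 1, ...).  In the two synchronous variants each iteration opens
   with a simultaneous start, so r is the iteration number; in the two
   asynchronous variants the only simultaneous start is r = 0.  Iterations are
   numbered from 0, and each of the functions below gives the time elapsed
   between two consecutive updates. *)

Definition K_sync_runtime (P K : nat) (z : nat -> 'I_P -> nat -> R) (n : nat) :
    R :=
  order_stat K (fun i => z n i 0).

Definition K_batch_sync_runtime (P K : nat) (z : nat -> 'I_P -> nat -> R)
    (n : nat) : R :=
  finish_time (z n) K.

(* State of the workers at the start of iteration n: the remaining time of the
   current mini-batch and the number of mini-batches started so far.  A worker
   whose remaining time does not exceed the duration of the iteration finishes,
   waits for the update and then starts its next mini-batch; the others go on.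
   Exact ties at the K-th position, where more than K workers restart, form a
   null event for continuous computation times. *)
Fixpoint K_async_state (P K : nat) (y : 'I_P -> nat -> R) (n : nat) :
    'I_P -> R * nat :=
  if n is n'.+1 then
    let s := K_async_state K y n' in
    let t := order_stat K (fun i => (s i).1) in
    fun i => if (s i).1 <= t then (y i (s i).2, (s i).2.+1)
             else ((s i).1 - t, (s i).2)
  else fun i => (y i 0%N, 1%N).

Definition K_async_runtime (P K : nat) (z : nat -> 'I_P -> nat -> R) (n : nat) :
    R :=
  order_stat K (fun i => (K_async_state K (z 0%N) n i).1).

Definition K_batch_async_runtime (P K : nat) (z : nat -> 'I_P -> nat -> R)
    (n : nat) : R :=
  finish_time (z 0%N) (n.+1 * K) - finish_time (z 0%N) (n * K).

End Runtimes.

(* A function F of the computation times, evaluated along the random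
   computation times Z. *)
Definition along d (T : measurableType d) (R : realType)
    (Pr : probability T R) (P : nat)
    (F : (nat -> 'I_P -> nat -> R) -> nat -> R)
    (Z : nat * 'I_P * nat -> {RV Pr >-> R}) (n : nat) : T -> R :=
  fun w => F (fun r i m => Z (r, i, m) w) n.

(* Main.v *)
Require Import Defs.
From HB Require Import structures.
From mathcomp Require Import all_boot all_order all_algebra.
From mathcomp Require Import all_classical all_reals all_analysis.
From mathcomp Require Import measurable_realfun.
From mathcomp Require Import zify ring lra.

(**
  Everything rests on the memoryless property.  Let [y i m] be i.i.d.
  exponential times and let t be the time of the first update of K-async SGD.
  Seen from t, an unfinished worker has the remaining time [y i 0 - t] followed
  by the untouched [y i 1], [y i 2], ..., and a finished worker has
  [y i 1], [y i 2], ...  This new family ([restart]) is again i.i.d.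
  exponential, so by induction every iteration of K-async SGD lasts as long,
  on average, as the first one, namely E[X_{K:P}].  For K = 1 the restart is a shift of the
  superposed process of all finished mini-batches (ties have probability 0), so
  the n-th of them is finished at expected time n E[X_{1:P}] = n / (P mu), which
  settles both batch variants.

  The law of an i.i.d. family is determined by its values on cylinders.  Hence
  a coordinate can be resampled independently without changing expectations,
  and it may be assumed that all times are nonnegative.

  For the order statistics, memorylessness gives
  E[sum_i (X_i - X_{k:P})^+] = (P - k) / mu; subtracting this identity for k + 1
  from that for k yields E[X_{k+1:P} - X_{k:P}] = 1 / ((P - k) mu).
*)

Set Implicit Arguments.
Unset Strict Implicit.
Unset Printing Implicit Defensive.

Import Order.TTheory GRing.Theory Num.Theory.
Import numFieldNormedType.Exports.

Local Open Scope classical_set_scope.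
Local Open Scope ring_scope.

(** * Families of random variables and their law *)

Section family_space.
Variables (R : realType) (I : eqType).

Definition cylinder (s : seq I) (A : I -> set R) : set (I -> R) :=
  [set y | forall i, i \in s -> A i (y i)].

(** Generators of the product sigma-algebra on [I -> R]. With [uniq s] the probability of a cylinder
    under an i.i.d. law is a product with one factor per index. *)
Definition cylinders : set (set (I -> R)) :=
  [set B | exists s A,
    [/\ uniq s, forall i, measurable (A i) & B = cylinder s A]].

Local Notation family_space := (g_sigma_algebraType cylinders).

Lemma measurable_cylinder s A : uniq s -> (forall i, measurable (A i)) ->
  measurable (cylinder s A : set family_space).
Proof. by move=> us mA; apply: sub_gen_smallest; exists s, A. Qed.

Lemma measurable_proj i : measurable_fun setT (fun y : family_space => y i).
Proof.
move=> _ A mA; rewrite setTI.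
rewrite (_ : _ @^-1` _ = cylinder [:: i] (fun=> A)).
  exact: measurable_cylinder.
apply/seteqP; split => y /=; first by move=> Ay j; rewrite inE => /eqP ->.
by apply; rewrite inE.
Qed.

Lemma measurable_family d (T : measurableType d) (Y : T -> I -> R) :
  (forall i, measurable_fun setT (Y ^~ i)) ->
  measurable_fun setT (Y : T -> family_space).
Proof.
move=> mY; apply: (@measurability _ _ T family_space setT Y cylinders erefl).
move=> _ [_ [s [A [us mA ->]]] <-]; rewrite setTI.
rewrite (_ : _ @^-1` _ = \bigcap_(i in [set` s]) (Y ^~ i @^-1` A i)).
  apply: fin_bigcap_measurable; first exact: finite_seq.
  by move=> i _; rewrite -[X in measurable X]setTI; apply: mY.
by apply/seteqP; split => w /=.
Qed.

Lemma cylinders_setI_closed : setI_closed cylinders.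
Proof.
move=> _ _ [s [A [us mA ->]]] [s' [A' [us' mA' ->]]].
(* The intersection constrains the union of both index lists; [undup] restores uniqueness, and
   [setT] stands for a list that does not mention [i]. *)
exists (undup (s ++ s')), (fun i => (if i \in s then A i else setT) `&`
                                  (if i \in s' then A' i else setT)).
split; first exact: undup_uniq.
  by move=> i; apply: measurableI; case: ifP.
apply/seteqP; split => y /=.
  by move=> [yA yA'] i _; split; case: ifP => // si; [exact: yA|exact: yA'].
by move=> yAA'; split => i si; have := yAA' i;
  rewrite mem_undup mem_cat si ?orbT => /(_ isT)[].
Qed.

(** Cylinders form a pi-system containing the whole space (take [s = [::]]), so finite measures
    agreeing on them are equal. *)
Lemma family_measure_unique (m1 m2 : {measure set family_space -> \bar R}) :
  (m1 setT < +oo)%E ->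
  (forall s A, uniq s -> (forall i, measurable (A i)) ->
    m1 (cylinder s A) = m2 (cylinder s A)) ->
  forall B, measurable B -> m1 B = m2 B.
Proof.
move=> m1T m12 B mB.
apply: (@measure_unique _ R family_space cylinders (fun=> setT) erefl) => //.
- exact: cylinders_setI_closed.
- by move=> _; exists [::], (fun=> setT); split => //; apply/seteqP; split.
- by rewrite bigcup_const.
- by move=> _ [s [A [us mA ->]]]; exact: m12.
Qed.

Definition upd (y : I -> R) (a : I) (c : R) : I -> R :=
  fun j => if j == a then c else y j.

Lemma upd_id y a : upd y a (y a) = y.
Proof. by apply/funext => j; rewrite /upd; case: eqP => // ->. Qed.

Lemma upd_upd y a c c' : upd (upd y a c) a c' = upd y a c'.
Proof. by apply/funext => j; rewrite /upd; case: eqP. Qed.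

Lemma upd_same y a c : upd y a c a = c.
Proof. by rewrite /upd eqxx. Qed.

Lemma upd_other y a c j : j != a -> upd y a c j = y j.
Proof. by rewrite /upd => /negPf ->. Qed.

Section iid.
Variable nu : probability R R.

(** Stated for a map into [I -> R], so that it also applies to families derived from the given
    variables, such as [restart K (Y w)] or the absolute values. *)
Definition iid d (T : measurableType d) (Pr : probability T R)
    (Y : T -> I -> R) : Prop :=
  (forall i, measurable_fun setT (Y ^~ i)) /\
  forall (s : seq I) (A : I -> set R), uniq s -> (forall i, measurable (A i)) ->
    Pr [set w | cylinder s A (Y w)] = (\prod_(i <- s) nu (A i))%E.

(** The two push-forward measures coincide by uniqueness on cylinders; a signed [F] is split into
    its positive and negative parts. *)
Lemma iid_transfer d (T : measurableType d) (Pr : probability T R)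
    d' (T' : measurableType d') (Pr' : probability T' R)
    (Y : T -> I -> R) (Y' : T' -> I -> R) (F : family_space -> \bar R) :
  iid Pr Y -> iid Pr' Y' -> measurable_fun [set: family_space] F ->
  (\int[Pr]_w F (Y w) = \int[Pr']_w F (Y' w))%E.
Proof.
move=> [mY iY] [mY' iY'] mF.
have mfY := measurable_family mY; have mfY' := measurable_family mY'.
have ge0 (G : family_space -> \bar R) : measurable_fun [set: family_space] G ->
    (forall y, 0 <= G y)%E ->
    (\int[Pr]_w G (Y w) = \int[Pr']_w G (Y' w))%E.
  move=> mG G0.
  transitivity (\int[pushforward Pr (Y : T -> family_space)]_y G y)%E.
    by rewrite ge0_integral_pushforward.
  transitivity (\int[pushforward Pr' (Y' : T' -> family_space)]_y G y)%E;
    last by rewrite ge0_integral_pushforward.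
  apply: eq_measure_integral => B mB _.
  apply: family_measure_unique => //.
    by rewrite /= /pushforward preimage_setT probability_setT ltry.
  by move=> s A us mA; rewrite /= /pushforward /= iY ?iY'.
rewrite (integralE _ _ (F \o Y)) (integralE _ _ (F \o Y')).
rewrite (funepos_comp F Y) (funeneg_comp F Y).
rewrite (funepos_comp F Y') (funeneg_comp F Y').
congr (_ - _)%E.
  exact: (ge0 (F^\+)%E (measurable_funepos mF) (funepos_ge0 F)).
exact: (ge0 (F^\-)%E (measurable_funeneg mF) (funeneg_ge0 F)).
Qed.

Lemma measurable_upd d (T : measurableType d) (Y : T -> I -> R) (c : T -> R) a :
  (forall i, measurable_fun setT (Y ^~ i)) -> measurable_fun setT c ->
  measurable_fun setT (fun w => upd (Y w) a (c w) : family_space).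
Proof.
move=> mY mc; apply: measurable_family => j.
by rewrite /upd; case: eqP.
Qed.

(** Under the product [Pr \x nu] the family with coordinate [a] replaced by the fresh variable has
    the same cylinder probabilities as [Y]; Tonelli then separates the fresh variable. *)
Lemma iid_resample d (T : measurableType d) (Pr : probability T R)
    (Y : T -> I -> R) (a : I) (F : family_space -> \bar R) :
  iid Pr Y -> measurable_fun [set: family_space] F -> (forall y, 0 <= F y)%E ->
  (\int[Pr]_w F (Y w) = \int[Pr]_w \int[nu]_x F (upd (Y w) a x))%E.
Proof.
move=> [mY iY] mF F0.
pose g (p : T * R) : family_space := upd (Y p.1) a p.2.
have mg : measurable_fun setT g.
  apply: (@measurable_upd _ _ (fun p : T * R => Y p.1) snd) => // i.
  exact: (measurableT_comp (mY i)).
have mfY := measurable_family mY.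
transitivity (\int[(Pr \x nu)%E]_p F (g p))%E; last first.
  rewrite fubini_tonelli1//.
  exact: (measurableT_comp mF mg).
transitivity (\int[pushforward Pr (Y : T -> family_space)]_y F y)%E.
  by rewrite ge0_integral_pushforward.
transitivity (\int[pushforward (Pr \x nu)%E g]_y F y)%E;
  last by rewrite ge0_integral_pushforward.
apply: eq_measure_integral => B mB _.
apply: family_measure_unique => //.
  by rewrite /= /pushforward preimage_setT probability_setT ltry.
move=> s A us mA; rewrite /= /pushforward.
rewrite [LHS]iY//.
(* The preimage of a cylinder is a rectangle: the constraint at [a], if any, falls on the fresh
   variable, all others on [Y]. *)
rewrite (_ : _ @^-1` _ = [set w | cylinder (rem a s) A (Y w)] `*`
    (if a \in s then A a else setT)); last first.
  apply/seteqP; split => -[w x] /=; rewrite /g /cylinder/=.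
    move=> H; split => [i|].
      rewrite mem_rem_uniq// inE => /andP[ia si].
      by have := H i si; rewrite upd_other.
    by case: ifPn => // sa; have := H a sa; rewrite upd_same.
  move=> [H ax] i si; have [ia|ia] := eqVneq i a.
    by subst i; rewrite upd_same; move: ax; rewrite si.
  by rewrite upd_other//; apply: H; rewrite mem_rem_uniq// inE ia.
rewrite [RHS]product_measure1E//; last 2 first.
- rewrite -[X in measurable X]setTI.
  by apply: mfY => //; apply: measurable_cylinder => //; exact: rem_uniq.
- by case: ifP.
rewrite /= iY//; last exact: rem_uniq.
case: ifPn => sa.
  by rewrite (perm_big _ (perm_to_rem sa)) big_cons muleC.
by rewrite rem_id// probability_setT mule1.
Qed.

End iid.
End family_space.

Notation family_space R I := (g_sigma_algebraType (@cylinders R I)).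

(** * The exponential law *)

Section exponential_law.
Variables (R : realType) (mu : R) (nu : probability R R).
Hypothesis mu_gt0 : 0 < mu.
Hypothesis nuE : forall A, measurable A -> nu A = exponential_prob mu A.

Lemma exponential_law_set1 (a : R) : nu [set a] = 0%E.
Proof. by rewrite nuE// /exponential_prob integral_set1. Qed.

Lemma exponential_law_lt0 : nu `]-oo, 0[%classic = 0%E.
Proof.
rewrite nuE// /exponential_prob; apply: integral0_eq => x /=.
by rewrite in_itv/= => x0; rewrite lt0_exponential_pdf.
Qed.

Lemma exponential_law_le0 : nu `]-oo, 0]%classic = 0%E.
Proof.
rewrite -(@setUitv1 _ R -oo%O 0 true)// measureU//.
- by rewrite [X in (X + _)%E]exponential_law_lt0 add0e;
  exact: exponential_law_set1.
- by apply/seteqP; split => // x [] /= /[swap] ->; rewrite in_itv/= ltxx.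
Qed.

(** The [Num.max] covers negative [a], where the tail is the full mass 1. *)
Lemma exponential_law_ray (a : R) :
  nu `]a, +oo[%classic = (expR (- mu * Num.max a 0))%:E.
Proof.
rewrite -setCitvl probability_setC//.
have [a0|a0] := leP a 0.
  rewrite mulr0 expR0 (_ : nu _ = 0%E) ?sube0//.
  apply: (@subset_measure0 _ _ _ nu _ `]-oo, 0]%classic) => //.
    by apply: subset_itvl; rewrite bnd_simp.
  exact: exponential_law_le0.
rewrite (_ : `]-oo, a]%classic = `]-oo, 0[ `|` `[0, a]); last first.
  by rewrite -itv_bndbnd_setU// bnd_simp ?ltW.
rewrite measureU//; last first.
  apply/seteqP; split => // x /= []; rewrite !in_itv/= => x0 /andP[].
  by rewrite leNgt x0.
rewrite [X in (1 - (X + _))%E]exponential_law_lt0 add0e.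
rewrite [X in (1 - X)%E]nuE// exponential_prob_itv0c//.
set e := expR _; have -> : (1 - (1 - e%:E) = (1 - (1 - e))%:E)%E by [].
by rewrite opprB addrC subrK.
Qed.

(** Restricted to the positive half-line, both sides are measures in [A] that agree on rays, because
    exponents add. The restriction matters: for [u > 0] the shifted law charges negative numbers,
    whereas [nu] does not. *)
Lemma exponential_law_shift (u : R) (A : set R) : 0 <= u ->
  measurable A -> A `<=` `]0, +oo[ ->
  nu [set x | A (x - u)] = ((expR (- mu * u))%:E * nu A)%E.
Proof.
move=> u0 mA A0.
pose phi (x : R) : R := x - u.
have mphi : measurable_fun setT phi by exact: measurable_funB.
have mD : measurable (`]0, +oo[%classic : set R) by exact: measurable_itv.
pose m1 := mrestr (pushforward nu phi) mD.
pose m2 := mscale (NngNum (expR_ge0 (- mu * u))) (mrestr nu mD).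
have m12 B : measurable B -> m1 B = m2 B.
  apply: (@measure_unique _ R _ (@RGenOInfty.G R)
    (fun n => `]- n%:R, +oo[%classic) (@RGenOInfty.measurableE R)).
  - move=> _ _ [a ->] [b ->]; exists (Num.max a b).
    apply/seteqP; split => x /=; rewrite !in_itv/= !andbT gt_max.
      by move=> [-> ->].
    by move=> /andP.
  - by move=> n; exists (- n%:R).
  - apply/seteqP; split => // x _; exists (Num.truncn `|x|).+1 => //=.
    rewrite in_itv/= andbT ltrNl.
    by rewrite (le_lt_trans (ler_norm _))// normrN truncnS_gt.
  - move=> _ [a ->]; change (nu (phi @^-1` (`]a, +oo[ `&` `]0%R, +oo[)) =
      ((expR (- mu * u))%:E * nu (`]a, +oo[ `&` `]0%R, +oo[))%E).
    have -> : `]a, +oo[ `&` `]0, +oo[ = `]Num.max a 0, +oo[%classic :> set R.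
      by apply/seteqP; split => x /=; rewrite !in_itv/= !andbT gt_max => /andP.
    rewrite (_ : phi @^-1` _ = `]Num.max a 0 + u, +oo[%classic).
      have : 0 <= Num.max a 0 by rewrite le_max lexx orbT.
      move: (Num.max a 0) => b b0.
      rewrite !exponential_law_ray -EFinM -expRD -mulrDr.
      by rewrite !max_l ?addr_ge0// addrC.
    by apply/seteqP; split => x /=; rewrite !in_itv/= !andbT ltrBrDr.
  - move=> n; change (nu (phi @^-1` (`](- n%:R)%R, +oo[ `&` `]0%R, +oo[)) <
    +oo)%E.
    apply: (@le_lt_trans _ _ 1%E); last exact: ltry.
    apply: probability_le1; rewrite -[X in measurable X]setTI.
    by apply: mphi => //; exact: measurableI.
have := m12 _ mA.
change (nu (phi @^-1` (A `&` `]0%R, +oo[)) =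
  ((expR (- mu * u))%:E * nu (A `&` `]0%R, +oo[))%E ->
  nu (phi @^-1` A) = ((expR (- mu * u))%:E * nu A)%E).
by rewrite setIidl.
Qed.

Lemma exponential_law_memoryless (u : R) (h : R -> \bar R) : 0 <= u ->
  measurable_fun setT h -> (forall x, 0 <= h x)%E ->
  (\int[nu]_x (h (x - u)%R * (\1_(`]u, +oo[%classic) x)%:E) =
   \int[nu]_x h x * nu `]u, +oo[%classic)%E.
Proof.
move=> u0 mh h0.
pose phi (x : R) : R := x - u.
have mphi : measurable_fun setT phi by exact: measurable_funB.
have mD : measurable (`]0, +oo[%classic : set R) by exact: measurable_itv.
have phiD : phi @^-1` `]0, +oo[ = `]u, +oo[%classic.
  by apply/seteqP; split => x /=; rewrite !in_itv/= !andbT subr_gt0.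
transitivity (\int[nu]_(x in `]u, +oo[) (h \o phi) x)%E.
  rewrite [RHS]integral_mkcond; apply: eq_integral => x _.
  by rewrite patchE indicE; case: ifPn => _; rewrite ?mule1 ?mule0.
rewrite -phiD -ge0_integral_pushforward//; last first.
  exact: measurable_funTS.
pose c := NngNum (expR_ge0 (- mu * u)).
rewrite (@eq_measure_integral _ _ _ _ (mscale c nu)); last first.
  by move=> A mA A0; exact: exponential_law_shift.
rewrite ge0_integral_mscale//; last exact: measurable_funTS.
rewrite phiD exponential_law_ray (max_idPl u0) muleC; congr (_ * _)%E.
(* The half-line []-oo, 0]] is null, so integrating over []0, +oo[] loses nothing. *)
rewrite -setCitvl -setTD; symmetry.
apply: ge0_negligible_integral => //.
exact: exponential_law_le0.
Qed.

(** The absolute value makes the variable nonnegative everywhere, so its mean is the integral of its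
    tail; the tail is [mu^-1] times the density, whose total mass is 1. *)
Lemma exponential_law_mean : (\int[nu]_x `|x|%:E = mu^-1%:E)%E.
Proof.
pose X : {mfun R >-> R} := @Num.norm R R.
have -> : (\int[nu]_x `|x|%:E = 'E_nu[X])%E by rewrite expectation_def.
rewrite ge0_expectation_ccdf; last by move=> x; exact: normr_ge0.
transitivity (\int[lebesgue_measure]_(r in `[0%R, +oo[)
    ((mu^-1)%:E * (exponential_pdf mu r)%:E))%E.
  apply: eq_integral => r; rewrite inE/= in_itv/= andbT => r0.
  rewrite exponential_pdfE// -EFinM mulrA mulVf ?gt_eqF// mul1r.
  rewrite /ccdf /distribution /pushforward.
  rewrite (_ : X @^-1` _ = `]-oo, (- r)[ `|` `]r, +oo[)%classic; last first.
    apply/seteqP; split => x; rewrite /preimage/= !in_itv/= !andbT ltr_normr.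
      by case/orP => ?; [right|left; rewrite ltrNr].
    by move=> [] ?; apply/orP; [right; rewrite ltrNr|left].
  rewrite measureU//; last first.
    apply/seteqP; split => // x /=; rewrite !in_itv/= andbT => -[xr rx].
    by have := lt_trans rx xr; rewrite ltNge ge0_cp.
  rewrite [X in (_ + X)%E](exponential_law_ray r) (max_idPl r0).
  rewrite [X in (X + _)%E](_ : _ = 0%E) ?add0e//.
  apply: (@subset_measure0 _ _ _ nu _ `]-oo, 0]%classic) => //.
    by apply: subset_itvl; rewrite bnd_simp oppr_le0.
  exact: exponential_law_le0.
rewrite ge0_integralZl//=.
- rewrite -[RHS]mule1; congr (_ * _)%E.
  rewrite -(integral_exponential_pdf mu_gt0) [LHS]integral_mkcond.
  apply: eq_integral => x _; rewrite patchE; case: ifPn => //.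
  rewrite notin_setE/= in_itv/= andbT => /negP; rewrite -ltNge => x0.
  by rewrite lt0_exponential_pdf.
- apply: measurable_funTS; apply/measurable_EFinP.
  exact: measurable_exponential_pdf.
- by move=> x _; rewrite lee_fin exponential_pdf_ge0// ltW.
- by rewrite lee_fin invr_ge0 ltW.
Qed.
End exponential_law.

(** * Order statistics *)

Section order_statistics.
Variable R : realType.
Implicit Types (s : seq R) (x : R).

Lemma count_take_sorted s k x : sorted <=%R s -> (0 < k <= size s)%N ->
  (nth 0 s k.-1 <= x) = (k <= count (fun y => y <= x)%R s)%N.
Proof.
move=> ss /andP[k0 ks].
have k1s : (k.-1 < size s)%N by rewrite prednK.
have sN i j : (i <= j < size s)%N -> nth 0 s i <= nth 0 s j.
  move=> /andP[ij js].
  by apply: (sorted_leq_nth le_trans le_refl) => //;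
    rewrite inE// (leq_ltn_trans ij).
apply/idP/idP => [kx|].
  rewrite -[s](cat_take_drop k) count_cat (leq_trans _ (leq_addr _ _))//.
  rewrite -[leqLHS](_ : size (take k s) = k); last by rewrite size_takel.
  rewrite leq_eqVlt eq_sym -all_count; apply/orP; left.
  apply/(all_nthP 0) => i; rewrite size_takel// => ik.
  rewrite nth_take//; apply: le_trans kx.
  by apply: sN; rewrite -ltnS prednK// ik.
apply: contraTT; rewrite -ltNge -ltnNge => xk.
rewrite -[s](cat_take_drop k.-1) count_cat.
rewrite [X in (_ + X)%N](_ : _ = 0%N); last first.
  apply/eqP; rewrite -leqn0 leqNgt -has_count; apply/negP => /(has_nthP 0)[i].
  rewrite size_drop ltn_subRL => ik; rewrite nth_drop leNgt => /negP; apply.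
  by apply: (lt_le_trans xk); apply: sN; rewrite leq_addr.
rewrite addn0; apply: (leq_ltn_trans (count_size _ _)).
by rewrite size_takel; [rewrite ltn_predL|exact: ltnW].
Qed.

(** Turns sorting into counting: order statistics and finishing times are compared below through the
    counts at every level [x]. *)
Lemma kth_smallest_le k s x : (0 < k <= size s)%N ->
  (kth_smallest k s <= x) = (k <= count (fun y => y <= x)%R s)%N.
Proof.
move=> ks; rewrite count_take_sorted ?size_sort//.
  by congr (_ <= _)%N; apply/permP; rewrite perm_sort.
exact: sort_le_sorted.
Qed.

Lemma kth_smallest_mem k s : (0 < k <= size s)%N -> kth_smallest k s \in s.
Proof.
move=> /andP[k0 ks]; rewrite -(mem_sort <=%R) mem_nth// size_sort.
by rewrite prednK.
Qed.

Lemma kth_smallest_ge0 k s : (forall x, x \in s -> 0 <= x) ->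
  0 <= kth_smallest k s.
Proof.
move=> s0; rewrite /kth_smallest.
have [ks|ks] := ltnP k.-1 (size (sort <=%R s)); last by rewrite nth_default.
by apply: s0; rewrite -(mem_sort <=%R) mem_nth.
Qed.

Section workers.
Variables (P K : nat).
Hypothesis KP : (0 < K <= P)%N.
Implicit Types v : 'I_P -> R.

Lemma size_workers v : size [seq v i | i <- enum 'I_P] = P.
Proof. by rewrite size_map size_enum_ord. Qed.

Lemma order_stat_le v x :
  (order_stat K v <= x) = (K <= \sum_(i < P) (v i <= x)%R)%N.
Proof.
rewrite kth_smallest_le ?size_workers//; congr (_ <= _)%N.
by rewrite count_map -sum1_count big_mkcond/= big_enum/=;
  apply: eq_bigr => i _; case: ifP.
Qed.

Lemma order_stat_mem v : exists i, order_stat K v = v i.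
Proof.
have /mapP[i _ ->] : order_stat K v \in [seq v i | i <- enum 'I_P].
  by apply: kth_smallest_mem; rewrite size_workers.
by exists i.
Qed.

Lemma order_stat_ge0 v : (forall i, 0 <= v i) -> 0 <= order_stat K v.
Proof. by move=> v0; have [i ->] := order_stat_mem v. Qed.

(** Counts at levels up to the K-th order statistic ignore how far an entry lies above it. This is
    what makes the random level in [memoryless_factor] independent of the resampled coordinate. *)
Lemma order_stat_move v v' (i : 'I_P) :
  (forall j, j != i -> v' j = v j) ->
  order_stat K v < v i -> order_stat K v < v' i ->
  order_stat K v' = order_stat K v.
Proof.
move=> vv'; set t := order_stat K v => tv tv'.
have count_eq x : x <= t ->
    (\sum_(j < P) (v' j <= x)%R = \sum_(j < P) (v j <= x)%R)%N.
  move=> xt; apply: eq_bigr => j _; have [->|/vv' ->//] := eqVneq j i.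
  by rewrite !leNgt (le_lt_trans xt tv) (le_lt_trans xt tv').
have E x : (order_stat K v' <= x) = (t <= x).
  have [tx|xt] := leP t x; last first.
    by rewrite order_stat_le count_eq ?ltW// -order_stat_le leNgt xt.
  by apply: le_trans tx; rewrite order_stat_le count_eq// -order_stat_le.
by apply/eqP; rewrite eq_le E lexx -E lexx.
Qed.

Lemma order_stat_lt_count v : injective v ->
  (\sum_(i < P) (order_stat K v < v i)%R = P - K)%N.
Proof.
move=> injv; pose s := sort <=%R [seq v i | i <- enum 'I_P].
have sz : size s = P by rewrite size_sort size_workers.
have us : uniq s by rewrite sort_uniq map_inj_uniq// enum_uniq.
have ss : sorted <=%R s by exact: sort_le_sorted.
have -> : (\sum_(i < P) (order_stat K v < v i)%R =
           \sum_(j < P) (order_stat K v < s`_j)%R)%N.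
  transitivity (\sum_(x <- s) (order_stat K v < x)%R)%N.
    by rewrite (perm_big _ (permEl (perm_sort _ _))) big_map big_enum.
  by rewrite (big_nth 0) sz big_mkord.
(* The K-th smallest entry sits at index [K.-1]; without ties, exactly the indices from [K] on lie
   strictly above it. *)
transitivity (\sum_(j < P) (K <= j))%N.
  apply: eq_bigr => j _; congr nat_of_bool.
  rewrite /order_stat /kth_smallest -/s.
  have K1P : (K.-1 < P)%N by lia.
  have sm a b : (a <= b)%N -> (a < P)%N -> (b < P)%N -> s`_a <= s`_b.
    move=> ab aP bP.
    by apply: (sorted_leq_nth le_trans le_refl) => //; rewrite inE sz.
  have [Kj|jK] := leqP K j; last first.
    by apply/negbTE; rewrite -leNgt sm//; lia.
  rewrite lt_neqAle nth_uniq ?sz//.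
  by rewrite sm//; lia.
rewrite -(big_mkord xpredT (fun j => nat_of_bool (K <= j)%N)).
rewrite (big_cat_nat (n := K))//=; last by case/andP: KP.
rewrite big_nat big1 ?add0n; last by move=> j /andP[_];
  rewrite ltnNge => /negbTE ->.
rewrite big_nat (eq_bigr (fun=> 1%N)); last by move=> j /andP[->].
by rewrite -big_nat sum_nat_const_nat muln1.
Qed.

End workers.

Lemma finish_time_le (P n : nat) (y : 'I_P -> nat -> R) x :
  (0 < P)%N -> (0 < n)%N ->
  (finish_time y n <= x) =
  (n <= \sum_(i < P) \sum_(m < n) (\sum_(j < m.+1) y i j <= x)%R)%N.
Proof.
move=> P0 n0; rewrite kth_smallest_le; last first.
  by rewrite n0 size_allpairs size_enum_ord size_iota leq_pmull.
congr (_ <= _)%N; rewrite count_flatten -map_comp sumnE big_map big_enum/=.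
apply: eq_bigr => i _; rewrite count_map -sum1_count big_mkcond/=.
rewrite -[X in iota _ X]subn0 -/(index_iota 0 n) big_mkord.
by apply: eq_bigr => m _; case: ifP.
Qed.

Lemma finish_time_ge0 (P n : nat) (y : 'I_P -> nat -> R) :
  (forall i m, 0 <= y i m) -> 0 <= finish_time y n.
Proof.
move=> y0; apply: kth_smallest_ge0 => x /allpairsP[[i m] [_ _ ->]].
by apply: sumr_ge0.
Qed.

End order_statistics.

(** * The first update *)

Section restart.
Variables (R : realType) (P K : nat).
Hypothesis KP : (0 < K <= P)%N.
Implicit Types y : 'I_P * nat -> R.

Definition first_update y : R := order_stat K (fun i => y (i, 0)%N).

(* The computation times seen from the first update of K-async SGD: a worker
   which has not finished has its remaining time as the duration of its first
   mini-batch. *)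
Definition restart y : 'I_P * nat -> R := fun j =>
  if y (j.1, 0%N) <= first_update y then y (j.1, j.2.+1)
  else if j.2 == 0%N then y (j.1, 0%N) - first_update y else y j.

Lemma restart_ge0 y : (forall j, 0 <= y j) -> forall j, 0 <= restart y j.
Proof.
move=> y0 j; rewrite /restart; case: ifPn => // yt; case: ifP => // _.
by rewrite subr_ge0 ltW// ltNge.
Qed.

Lemma K_async_stateS (z : 'I_P -> nat -> R) n i :
  let s := K_async_state K z n in
  let t := order_stat K (fun i => (s i).1) in
  K_async_state K z n.+1 i =
  if (s i).1 <= t then (z i (s i).2, (s i).2.+1) else ((s i).1 - t, (s i).2).
Proof. by []. Qed.

Lemma restart_gt0 y i m : (0 < m)%N ->
  restart y (i, m) = y (i, (m + (y (i, 0%N) <= first_update y)%R)%N).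
Proof.
move=> m0; rewrite /restart/= gtn_eqF//.
by case: (_ <= _); rewrite ?addn1 ?addn0.
Qed.

(** Remaining times agree, while the counter of a worker that finished at the first update is one
    ahead, since [restart] has dropped its first mini-batch. Positivity of the counter ensures that
    the next time read is not at index 0, the only one that [restart] shortens. *)
Lemma K_async_state_restart y n i :
  let s := K_async_state K (fun i m => restart y (i, m)) n i in
  (0 < s.2)%N /\
  K_async_state K (fun i m => y (i, m)) n.+1 i =
    (s.1, (s.2 + (y (i, 0%N) <= first_update y)%R)%N).
Proof.
elim: n i => [|n IHn] i.
  by rewrite /= /restart/= -/(first_update y); case: (_ <= _).
rewrite [K_async_state K _ n.+2 i]K_async_stateS.
have -> : order_stat K
      (fun i => (K_async_state K (fun i m => y (i, m)) n.+1 i).1) =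
    order_stat K
      (fun i => (K_async_state K (fun i m => restart y (i, m)) n i).1).
  by congr (order_stat K _); apply/funext => k; have [_ ->] := IHn k.
have [c0 ->] := IHn i.
rewrite K_async_stateS; move: c0.
case: (K_async_state K _ n i) => r c /= c0.
by case: ifP => //= _; rewrite restart_gt0.
Qed.

Lemma K_async_runtime_restart y n :
  order_stat K (fun i => (K_async_state K (fun i m => y (i, m)) n.+1 i).1) =
  order_stat K
    (fun i => (K_async_state K (fun i m => restart y (i, m)) n i).1).
Proof.
congr (order_stat K _); apply/funext => i.
by have [_ ->] := K_async_state_restart y n i.
Qed.
End restart.

(** * Restarting the superposed process at its first finished mini-batch *)

Section restart1.
Variables (R : realType) (P : nat).
Hypothesis P0 : (0 < P)%N.
Implicit Types y : 'I_P * nat -> R.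

(** By injectivity exactly one worker [i0] finishes at the first update. Its later finishing times
    move down by one index, those of the others keep their index, and all are delayed by [t]. *)
Lemma finish_time_restart y n : (forall j, 0 <= y j) ->
  injective (fun i => y (i, 0%N)) ->
  finish_time (fun i m => y (i, m)) n.+1 =
  first_update 1 y + finish_time (fun i m => restart 1 y (i, m)) n.
Proof.
move=> y0 inj.
have KP : (0 < 1 <= P)%N by [].
set t := first_update 1 y.
have [i0 ti0] : exists i0, t = y (i0, 0%N) := order_stat_mem KP _.
have ti i : t <= y (i, 0%N).
  rewrite leNgt; apply/negP => /[dup] iyt.
  rewrite ltNge => /negP; apply; rewrite (order_stat_le KP).
  by rewrite (bigD1 i)//= lexx.
have ti' i : i != i0 -> (y (i, 0%N) <= t) = false.
  move=> ii0; apply/negbTE; rewrite -ltNge lt_neqAle ti andbT.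
  by apply: contra_neq ii0; rewrite ti0 => /inj.
pose S i m := \sum_(j < m.+1) y (i, nat_of_ord j).
pose S' i m := \sum_(j < m.+1) restart 1 y (i, nat_of_ord j).
have S'0 i m : 0 <= S' i m.
  by apply: sumr_ge0 => j _; exact: restart_ge0.
have S'i0 m : S i0 m.+1 = t + S' i0 m.
  rewrite /S big_ord_recl/= -ti0; congr (_ + _).
  by apply: eq_bigr => j _; rewrite /restart/= -/t -ti0 lexx.
have S'i i m : i != i0 -> S i m = t + S' i m.
  move=> ii0; rewrite /S /S' 2!big_ord_recl/= {1}/restart/= -/t ti'//=.
  rewrite addrA [t + _]addrC subrK; congr (_ + _).
  by apply: eq_bigr => j _; rewrite /restart/= -/t ti'.
have S'S i m m' : (m <= m')%N -> S' i m <= S' i m'.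
  move=> mm'; rewrite /S' -(subnK mm') addnC -addSn big_split_ord/= lerDl.
  by apply: sumr_ge0 => j _; exact: restart_ge0.
suff E x : (finish_time (fun i m => y (i, m)) n.+1 <= x) =
    (t + finish_time (fun i m => restart 1 y (i, m)) n <= x).
  by apply/eqP; rewrite eq_le E lexx -E lexx.
rewrite finish_time_le// -lerBrDl.
have -> : (\sum_(i < P) \sum_(m < n.+1)
      (\sum_(j < m.+1) y (i, nat_of_ord j) <= x)%R =
    (t <= x)%R + \sum_(m < n) (S' i0 m <= x - t)%R +
    \sum_(i < P | i != i0) \sum_(m < n.+1) (S' i m <= x - t)%R)%N.
  rewrite (bigD1 i0)//= big_ord_recl/= big_ord1 -ti0.
  congr (_ + _ + _)%N.
    apply: eq_bigr => m _; rewrite -/(S i0 _) /bump /= add1n.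
    by rewrite S'i0 lerBrDl.
  apply: eq_bigr => i ii0; apply: eq_bigr => m _.
  by rewrite -/(S i m) S'i// lerBrDl.
have [tx|xt] := leP t x; last first.
  rewrite big1 => [|m _]; last first.
    by apply/eqP; rewrite eqb0 -ltNge (lt_le_trans _ (S'0 _ _))// subr_lt0.
  rewrite big1 => [|i _]; last first.
    rewrite big1// => m _.
    by apply/eqP; rewrite eqb0 -ltNge (lt_le_trans _ (S'0 _ _))// subr_lt0.
  apply/esym/negbTE; rewrite -ltNge.
  apply: (@lt_le_trans _ _ 0); first by rewrite subr_lt0.
  by apply: finish_time_ge0 => i m; exact: restart_ge0.
rewrite add1n addSn ltnS.
(* For [n = 0] the restarted finishing time is the default value 0 of an empty list. *)
case: n => [|n].
  rewrite leq0n; apply/esym.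
  by rewrite /finish_time /kth_smallest nth_default ?subr_ge0// size_sort;
    elim: (enum _).
rewrite finish_time_le// [in RHS](bigD1 i0)//=.
under [in RHS]eq_bigr do under eq_bigr do rewrite -/(S' _ _).
under [in X in (_ + X)%N]eq_bigr do under eq_bigr do rewrite -/(S' _ _).
(* For workers other than [i0] the left count ranges over one more mini-batch, the one of index
   [n.+1]. If some worker has finished it in time, that worker alone brings both counts up to
   [n.+1]; otherwise the extra terms vanish. *)
have [/existsP[i /andP[ii0 in1]]|] :=
    boolP [exists i, (i != i0) && (S' i n.+1 <= x - t)].
  have H q : (n < q)%N -> (q <= n.+2)%N -> (n < \sum_(m < q) (S' i m <= x -
    t)%R)%N.
    move=> nq qn; rewrite (eq_bigr (fun=> 1%N)); last first.
      by move=> m _; rewrite (le_trans (S'S i m n.+1 _) in1)// -ltnS (leq_trans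
        _ qn).
    by rewrite sum1_card card_ord.
  rewrite (bigD1 i)//= (leq_trans (H n.+2 _ _)) ?leqnSn//; last first.
    by rewrite addnCA leq_addr.
  apply/esym.
  rewrite [in X in (_ + X)%N](bigD1 i)//= (leq_trans (H n.+1 _ _))//.
  by rewrite addnCA leq_addr.
rewrite negb_exists => /forallP nx.
congr (_ <= _ + _)%N; apply: eq_bigr => i ii0.
by have := nx i; rewrite ii0/= big_ord_recr/= => /negbTE ->; rewrite addn0.
Qed.
End restart1.

(** * Total excess over an order statistic *)

Section excess.
Variables (R : realType) (P : nat).
Implicit Types v : 'I_P -> R.

(* Extends order_stat, whose value at index 0 is that at index 1, by 0. *)
Definition order_stat0 k v : R := if k is 0 then 0 else order_stat k v.

(** Raising the level to the next order statistic shortens the excess of the [P - k] upper entries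
    by the gap; the [k] lower entries have excess 0 at both levels. *)
Lemma excess_order_stat0 k v : (k < P)%N -> (forall i, 0 <= v i) ->
  \sum_(i < P) Num.max (v i - order_stat0 k v) 0 =
  \sum_(i < P) Num.max (v i - order_stat0 k.+1 v) 0 +
  (P - k)%:R * (order_stat0 k.+1 v - order_stat0 k v).
Proof.
move=> kP v0; pose s := sort <=%R [seq v i | i <- enum 'I_P].
have sz : size s = P by rewrite size_sort size_workers.
have ss : sorted <=%R s by exact: sort_le_sorted.
have sm a b : (a <= b)%N -> (b < P)%N -> s`_a <= s`_b.
  move=> ab bP.
  by apply: (sorted_leq_nth le_trans le_refl) => //;
    rewrite inE sz// (leq_ltn_trans ab).
have sumE (f : R -> R) : \sum_(i < P) f (v i) = \sum_(j < P) f s`_j.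
  transitivity (\sum_(x <- s) f x).
    by rewrite (perm_big _ (permEl (perm_sort _ _))) big_map big_enum.
  by rewrite (big_nth 0) sz big_mkord.
set a := order_stat0 k v; set b := order_stat0 k.+1 v.
have bE : b = s`_k by [].
have ale j : (k <= j < P)%N -> a <= s`_j.
  move=> /andP[kj jP]; rewrite /a; case: (k) kj => [_|k' k'j] /=; last first.
    by rewrite /order_stat /kth_smallest sm//= ltnW.
  have : s`_j \in s by rewrite mem_nth ?sz.
  by rewrite mem_sort => /mapP[i _ ->].
have age j : (j < k)%N -> s`_j <= a.
  rewrite /a; case: (k) kP => // k' k'P; rewrite ltnS => jk.
  by rewrite /order_stat0 /order_stat /kth_smallest sm// ltnW.
rewrite (sumE (fun x => Num.max (x - a) 0)) (sumE (fun x => Num.max (x - b) 0)).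
have -> : (P - k)%:R * (b - a) = \sum_(j < P) (if (k <= j)%N then b - a else 0).
  rewrite -(big_mkord xpredT (fun j => if (k <= j)%N then b - a else 0)).
  rewrite (big_cat_nat (n := k))//=; last exact: ltnW.
  rewrite big_nat big1 ?add0r; last by move=> j /andP[_];
    rewrite ltnNge => /negbTE ->.
  rewrite big_nat (eq_bigr (fun=> b - a)); last by move=> j /andP[->].
  by rewrite -big_nat sumr_const_nat mulr_natl.
rewrite -big_split/=; apply: eq_bigr => j _; case: ifPn => kj.
  rewrite !max_l ?subr_ge0 ?ale ?kj//=; last by rewrite bE sm.
  by rewrite addrA subrK.
rewrite -ltnNge in kj; rewrite !max_r ?addr0// subr_le0 ?age//.
by rewrite bE sm// ltnW.
Qed.

Lemma order_stat0_ge0 k v : (k <= P)%N -> (forall i, 0 <= v i) ->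
  0 <= order_stat0 k v.
Proof. by case: k => // k kP v0; apply: order_stat_ge0. Qed.

Lemma order_stat0_leS k v : (k < P)%N -> (forall i, 0 <= v i) ->
  order_stat0 k v <= order_stat0 k.+1 v.
Proof.
case: k => [|k] kP v0; first exact: order_stat_ge0.
rewrite /= /order_stat /kth_smallest /=.
apply: (sorted_leq_nth le_trans le_refl) => //; first exact: sort_le_sorted.
  by rewrite inE size_sort size_workers ltnW.
by rewrite inE size_sort size_workers.
Qed.

Lemma order_stat0_lt_count k v : (k <= P)%N -> injective v ->
  (forall i, 0 < v i) ->
  (\sum_(i < P) (order_stat0 k v < v i)%R = P - k)%N.
Proof.
case: k => [|k] kP injv v0; last exact: order_stat_lt_count.
rewrite subn0 (eq_bigr (fun=> 1%N)); last by move=> i _ /=; rewrite v0.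
by rewrite sum1_card card_ord.
Qed.

Lemma order_stat0_move k v v' (i : 'I_P) : (k <= P)%N ->
  (forall j, j != i -> v' j = v j) ->
  order_stat0 k v < v i -> order_stat0 k v < v' i ->
  order_stat0 k v' = order_stat0 k v.
Proof. by case: k => // k kP; apply: order_stat_move. Qed.
End excess.

(** * Measurability of order statistics, finishing times and runtimes *)

Section measurability.
Context d (T : measurableType d) (R : realType).

Lemma measurable_kth_smallest (J : Type) k (s : seq J) (f : J -> T -> R) :
  (forall j, measurable_fun setT (f j)) ->
  measurable_fun setT (fun w => kth_smallest k [seq f j w | j <- s]).
Proof.
move=> mf.
have [ks|ks] := leqP (size s) k.-1.
  rewrite (_ : (fun w => _) = cst 0)//; apply/funext => w.
  by rewrite /kth_smallest nth_default// size_sort size_map.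
apply: (@measurability _ _ T R setT _ (@RGenOInfty.G R)
  (@RGenOInfty.measurableE R)) => _ [_ [x ->] <-]; rewrite setTI.
pose g (w : T) : R := \sum_(j <- s) if f j w <= x then 1 else 0.
(* The value at [k = 0] equals that at [k = 1], as both read index 0; [k.-1.+1] treats the two cases
   together. *)
have gE w : (x < kth_smallest k [seq f j w | j <- s]) = (g w < k.-1.+1%:R).
  rewrite -[kth_smallest k _]/(kth_smallest k.-1.+1 _) ltNge kth_smallest_le.
    rewrite -ltnNge count_map -sum1_count big_mkcond/= -(ltr_nat R) natr_sum.
    by congr (_ < _); apply: eq_bigr => j _; case: ifP.
  by rewrite size_map.
set A := (X in measurable X).
have -> : A = g @^-1` `]-oo, k.-1.+1%:R[%classic.
  by apply/seteqP; split => w; rewrite /A /preimage/= !in_itv/= andbT gE.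
rewrite -[X in measurable X]setTI.
apply: (@measurable_sum _ T R setT J s) => // j.
by apply: measurable_fun_ifT => //; exact: measurable_fun_ler.
Qed.

Lemma measurable_order_stat P k (f : 'I_P -> T -> R) :
  (forall i, measurable_fun setT (f i)) ->
  measurable_fun setT (fun w => order_stat k (fun i => f i w)).
Proof. exact: measurable_kth_smallest. Qed.

Lemma measurable_order_stat0 P k (f : 'I_P -> T -> R) :
  (forall i, measurable_fun setT (f i)) ->
  measurable_fun setT (fun w => order_stat0 k (fun i => f i w)).
Proof. by case: k => // k; exact: measurable_order_stat. Qed.

Lemma measurable_finish_time P n (f : 'I_P -> nat -> T -> R) :
  (forall i m, measurable_fun setT (f i m)) ->
  measurable_fun setT (fun w => finish_time (fun i m => f i m w) n).
Proof.
move=> mf.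
rewrite (_ : (fun w => _) = (fun w => kth_smallest n
    [seq \sum_(j < p.2.+1) f p.1 j w |
     p <- [seq (i, m) | i <- enum 'I_P, m <- iota 0 n]])).
  apply: measurable_kth_smallest => -[i m] /=.
  exact: (@measurable_sum _ _ _ _ _ _ (fun j : 'I_m.+1 => f i j)).
by apply/funext => w; rewrite map_allpairs.
Qed.

Lemma measurable_restart P K (Y : T -> 'I_P * nat -> R) :
  (forall j, measurable_fun setT (Y ^~ j)) ->
  forall j, measurable_fun setT (fun w => restart K (Y w) j).
Proof.
move=> mY j; rewrite /restart.
have mt : measurable_fun setT (fun w => first_update K (Y w)).
  exact: measurable_order_stat.
apply: measurable_fun_ifT => //; first exact: measurable_fun_ler.
by case: (j.2 == 0%N) => //; exact: measurable_funB.
Qed.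

Lemma measurable_K_async_runtime P K n (Y : T -> 'I_P * nat -> R) :
  (forall j, measurable_fun setT (Y ^~ j)) ->
  measurable_fun setT (fun w => order_stat K
    (fun i => (K_async_state K (fun i m => Y w (i, m)) n i).1)).
Proof.
elim: n Y => [|n IHn] Y mY.
  exact: (@measurable_order_stat P K (fun i w => Y w (i, 0%N))).
under eq_fun do rewrite K_async_runtime_restart.
by apply: (IHn (fun w => restart K (Y w))); exact: measurable_restart.
Qed.
End measurability.

(** * Memorylessness *)

Section factorization.
Variables (R : realType) (I : eqType) (nu : probability R R).
Context d (T : measurableType d) (Pr : probability T R).
Variables (Y : T -> I -> R) (a : I).
Hypothesis iidY : iid nu Pr Y.
Implicit Types (y : I -> R) (E : set (family_space R I)).

Let mY : measurable_fun setT (Y : T -> family_space R I).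
Proof. exact: measurable_family iidY.1. Qed.

Let mupd y : measurable_fun setT (fun x => upd y a x : family_space R I).
Proof. exact: (@measurable_upd _ _ _ R (fun=> y)). Qed.

(** Resampling [a] reduces a factorization under [Pr] to one under [nu], with all other coordinates
    frozen. *)
Lemma iid_factor (g : family_space R I -> \bar R) E (H : \bar R) :
  measurable_fun setT g -> (forall y, 0 <= g y)%E -> measurable E ->
  (0 <= H)%E ->
  (forall y, \int[nu]_x g (upd y a x) = H * nu [set x | E (upd y a x)])%E ->
  (\int[Pr]_w g (Y w) = H * Pr [set w | E (Y w)])%E.
Proof.
move=> mg g0 mE H0 gE.
have mI : measurable_fun setT (fun y : family_space R I => (\1_E y : R)%:E).
  exact/measurable_EFinP/measurable_indic.
have indicE y : (\int[nu]_x (\1_E (upd y a x))%:E =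
    nu [set x | E (upd y a x)])%E.
  rewrite (eq_integral (fun x => (\1_[set x | E (upd y a x)] x)%:E)) //.
  rewrite integral_indic ?setIT//.
  by rewrite -[X in measurable X]setTI; exact: mupd.
rewrite (iid_resample a iidY)//.
under eq_integral do rewrite gE -indicE.
rewrite ge0_integralZl//.
- rewrite -(iid_resample a iidY (F := fun y => (\1_E y)%:E))//; congr (_ * _)%E.
  rewrite (eq_integral (fun w => (\1_[set w | E (Y w)] w)%:E)) //.
  rewrite integral_indic ?setIT//.
  by rewrite -[X in measurable X]setTI; exact: mY.
- have := @measurable_fun_fubini_tonelli_F _ _ T R R nu
    (fun p => (\1_E (upd (Y p.1) a p.2))%:E).
  apply => [|p]; last by rewrite lee_fin.
  apply: (measurableT_comp mI).
  apply: (@measurable_upd _ _ _ _ (fun p : T * R => Y p.1) snd) => // i.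
  exact: (measurableT_comp (iidY.1 i)).
- by move=> w _; apply: integral_ge0 => x _; rewrite lee_fin.
Qed.

(** [E] is insensitive to coordinate [a], so each of its sections along [a] is everything or
    empty. *)
Lemma fresh_factor E (h : R -> \bar R) :
  measurable E -> measurable_fun setT h -> (forall x, 0 <= h x)%E ->
  (forall y c, E y -> E (upd y a c)) ->
  (\int[Pr]_w (h (Y w a) * (\1_E (Y w))%:E) =
   (\int[nu]_x h x) * Pr [set w | E (Y w)])%E.
Proof.
move=> mE mh h0 Eupd.
apply: (iid_factor (g := fun y => h (y a) * (\1_E y)%:E)%E) => //.
- apply: emeasurable_funM.
    by apply: (measurableT_comp mh); exact: measurable_proj.
  exact/measurable_EFinP/measurable_indic.
- by move=> y; rewrite mule_ge0// lee_fin.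
- exact: integral_ge0.
move=> y; under eq_integral do rewrite upd_same.
have [Ey|nEy] := pselect (E y).
  have -> : [set x | E (upd y a x)] = setT.
    by apply/seteqP; split => // x _; exact: Eupd.
  rewrite probability_setT mule1; apply: eq_integral => x _.
  by rewrite indicE mem_set ?mule1//; exact: Eupd.
have nE x : ~ E (upd y a x).
  by move=> /(Eupd _ (y a)); rewrite upd_upd upd_id.
have -> : [set x | E (upd y a x)] = set0 by apply/seteqP; split.
rewrite measure0 mule0; apply: integral0_eq => x _.
by rewrite indicE memNset ?mule0//.
Qed.

Lemma fresh_factor_prob E A : measurable E -> measurable A ->
  (forall y c, E y -> E (upd y a c)) ->
  Pr [set w | A (Y w a) /\ E (Y w)] = (nu A * Pr [set w | E (Y w)])%E.
Proof.
move=> mE mA Eupd.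
have mT (B : set (family_space R I)) : measurable B ->
    measurable [set w | B (Y w)].
  by move=> mB; rewrite -[X in measurable X]setTI; exact: mY.
transitivity (\int[Pr]_w ((\1_A (Y w a))%:E * (\1_E (Y w))%:E))%E.
  rewrite (eq_integral
    (fun w => (\1_[set w | A (Y w a) /\ E (Y w)] w)%:E)) => [|w _].
    rewrite integral_indic ?setIT//.
    rewrite (_ : [set w | _] = [set w | A (Y w a)] `&` [set w | E (Y w)])//.
    apply: measurableI; last exact: mT.
    by rewrite -[X in measurable X]setTI; exact: iidY.1.
  rewrite -EFinM !indicE -natrM mulnb; congr ((nat_of_bool _)%:R%:E).
  apply/idP/idP => [/andP[]|]; rewrite !inE//= => -[Aw Ew].
  by apply/andP; rewrite !inE.
rewrite (fresh_factor (h := fun x => (\1_A x)%:E))//.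
- by rewrite integral_indic ?setIT.
- exact/measurable_EFinP/measurable_indic.
Qed.

Variable mu : R.
Hypothesis nuE : forall B, measurable B -> nu B = exponential_prob mu B.

(* Memorylessness with a random level: on E, the level t is exceeded by y a but
   does not depend on it. *)
Lemma memoryless_factor E (t : family_space R I -> R) (h : R -> \bar R) :
  measurable E -> measurable_fun setT t ->
  measurable_fun setT h -> (forall x, 0 <= h x)%E ->
  (forall y, E y -> 0 <= t y < y a) ->
  (forall y c, E y -> t y < c -> E (upd y a c) /\ t (upd y a c) = t y) ->
  (\int[Pr]_w (h (Y w a - t (Y w))%R * (\1_E (Y w))%:E) =
   (\int[nu]_x h x) * Pr [set w | E (Y w)])%E.
Proof.
move=> mE mt mh h0 Et Eupd.
apply: (iid_factor (g := fun y => h (y a - t y)%R * (\1_E y)%:E)%E) => //.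
- apply: emeasurable_funM.
    apply: (measurableT_comp mh); apply: measurable_funB => //.
    exact: measurable_proj.
  exact/measurable_EFinP/measurable_indic.
- by move=> y; rewrite mule_ge0// lee_fin.
- exact: integral_ge0.
move=> y; under eq_integral do rewrite upd_same.
(* The section of [E] along [a] is empty or the ray above the level [u], to which memorylessness of
   [nu] applies. *)
have [[c0 Ec0]|nE] := pselect (exists c, E (upd y a c)); last first.
  have -> : [set x | E (upd y a x)] = set0.
    by apply/seteqP; split => // x Ex; apply: nE; exists x.
  rewrite measure0 mule0; apply: integral0_eq => x _.
  by rewrite indicE memNset ?mule0// => Ex; apply: nE; exists x.
set u := t (upd y a c0).
have /andP[u0 uc0] : 0 <= u < c0 by have := Et _ Ec0; rewrite upd_same.
have Eu c : u < c -> E (upd y a c) /\ t (upd y a c) = u.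
  by move=> uc; have := Eupd _ c Ec0 uc; rewrite upd_upd.
(* The levels at [c0] and at [c] agree, because raising the coordinate to [Num.max c0 c] preserves
   both. *)
have uE c : E (upd y a c) -> u < c.
  move=> Ec; have := Et _ Ec; rewrite upd_same => /andP[_ tc].
  have c01 : u < Num.max c0 c by rewrite lt_max uc0.
  have c1 : t (upd y a c) < Num.max c0 c by rewrite lt_max tc orbT.
  have [_ <-] := Eu _ c01.
  by have [_] := Eupd _ _ Ec c1; rewrite upd_upd => ->.
have -> : [set x | E (upd y a x)] = `]u, +oo[%classic.
  apply/seteqP; split => x /=; rewrite in_itv/= andbT; first exact: uE.
  by move=> /Eu[].
rewrite -(exponential_law_memoryless nuE u0 mh h0).
apply: eq_integral => x _; have [ux|xu] := ltP u x.
  have [Ex ->] := Eu _ ux.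
  by rewrite !indicE !mem_set//= in_itv/= ux.
rewrite !indicE !memNset ?mule0//= ?in_itv/= ?andbT ?ltNge ?xu//.
by move=> /uE; rewrite ltNge xu.
Qed.

Lemma memoryless_factor_prob E (t : family_space R I -> R) A :
  measurable E -> measurable_fun setT t -> measurable A ->
  (forall y, E y -> 0 <= t y < y a) ->
  (forall y c, E y -> t y < c -> E (upd y a c) /\ t (upd y a c) = t y) ->
  Pr [set w | A (Y w a - t (Y w)) /\ E (Y w)] =
  (nu A * Pr [set w | E (Y w)])%E.
Proof.
move=> mE mt mA Et Eupd.
have mT (B : set (family_space R I)) : measurable B ->
    measurable [set w | B (Y w)].
  by move=> mB; rewrite -[X in measurable X]setTI; exact: mY.
transitivity
    (\int[Pr]_w ((\1_A (Y w a - t (Y w))%R)%:E * (\1_E (Y w))%:E))%E.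
  rewrite (eq_integral
    (fun w => (\1_[set w | A (Y w a - t (Y w)) /\ E (Y w)] w)%:E)) => [|w _].
    rewrite integral_indic ?setIT//.
    rewrite (_ : [set w | _] =
      [set w | A (Y w a - t (Y w))] `&` [set w | E (Y w)])//.
    apply: measurableI; last exact: mT.
    rewrite -[X in measurable X]setTI.
    have : measurable_fun setT (fun w => Y w a - t (Y w)).
      apply: measurable_funB; first exact: iidY.1.
      exact: (measurableT_comp mt mY).
    exact.
  rewrite -EFinM !indicE -natrM mulnb; congr ((nat_of_bool _)%:R%:E).
  apply/idP/idP => [/andP[]|]; rewrite !inE//= => -[Aw Ew].
  by apply/andP; rewrite !inE.
rewrite (memoryless_factor (h := fun x => (\1_A x)%:E))//.
- by rewrite integral_indic ?setIT.
- exact/measurable_EFinP/measurable_indic.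
Qed.
End factorization.

(** * The restarted family is again i.i.d *)

Section iid_restart.
Variables (R : realType) (P K : nat).
Hypothesis KP : (0 < K <= P)%N.
Implicit Types y : 'I_P * nat -> R.

Lemma first_update_upd y i m c : (0 < m)%N ->
  first_update K (upd y (i, m) c) = first_update K y.
Proof.
move=> m0; congr (order_stat K _); apply/funext => k; rewrite upd_other//.
by apply/eqP => -[_ m_eq]; rewrite -m_eq in m0.
Qed.

(** Independence after the restart rests on this lemma, [restart_upd_gt] and [restart_upd0]: the
    coordinate of [y] from which one entry of [restart K y] is read affects no other entry. For a
    finished worker it is [(i, m.+1)]. *)
Lemma restart_upd_le y i m c j : y (i, 0%N) <= first_update K y ->
  j != (i, m) -> restart K (upd y (i, m.+1) c) j = restart K y j.
Proof.
move=> yt jim; rewrite /restart first_update_upd// upd_other; last first.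
  by apply/eqP => -[].
case: ifPn => jt.
  by rewrite upd_other//; apply: contra jim => /eqP[<- <-].
case: ifPn => // _; rewrite upd_other//.
by apply: contra jt => /eqP ->.
Qed.

Lemma restart_upd_gt y i m c j : first_update K y < y (i, 0%N) ->
  (0 < m)%N -> j != (i, m) -> restart K (upd y (i, m) c) j = restart K y j.
Proof.
move=> yt m0 jim; rewrite /restart first_update_upd// upd_other; last first.
  by apply/eqP => -[_ m_eq]; rewrite -m_eq in m0.
case: ifPn => jt; last by rewrite upd_other.
rewrite upd_other//; apply: contraTN jt => /eqP[-> _].
by rewrite -ltNge.
Qed.

Lemma first_update_upd0 y i c : first_update K y < y (i, 0%N) ->
  first_update K y < c -> first_update K (upd y (i, 0%N) c) = first_update K y.
Proof.
move=> yt tc; apply: (order_stat_move KP) yt _; last by rewrite upd_same.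
by move=> k ki; rewrite upd_other//; apply: contra ki => /eqP[->].
Qed.

Lemma restart_upd0 y i c j : first_update K y < y (i, 0%N) ->
  first_update K y < c -> j != (i, 0%N) ->
  restart K (upd y (i, 0%N) c) j = restart K y j.
Proof.
move=> yt tc ji; rewrite /restart first_update_upd0//.
have [ji1|ji1] := eqVneq j.1 i.
  rewrite ji1 upd_same leNgt tc/= leNgt yt/=.
  rewrite (upd_other _ _ ji) ifN ?ifN//;
    by apply: contra ji => /eqP j0; case: (j) ji1 j0 => /= ? ? -> ->.
have u m : upd y (i, 0%N) c (j.1, m) = y (j.1, m).
  by rewrite upd_other//; apply: contra ji1 => /eqP[->].
by rewrite !u upd_other.
Qed.

Variables (mu : R) (nu : probability R R).
Hypothesis nuE : forall B, measurable B -> nu B = exponential_prob mu B.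
Context d (T : measurableType d) (Pr : probability T R).

(** Indices are peeled off the cylinder one at a time. Whether or not worker [i] has finished, the
    entry at [(i, m)] contributes the factor [nu (A (i, m))], and the two cases add up. *)
Lemma iid_restart (Y : T -> 'I_P * nat -> R) :
  iid nu Pr Y -> (forall w j, 0 <= Y w j) ->
  iid nu Pr (fun w => restart K (Y w)).
Proof.
move=> iidY Y0; have mY := iidY.1.
split; first exact: measurable_restart.
move=> s A + mA; elim: s => [|[i m] s IHs] us.
  rewrite big_nil -[RHS](@probability_setT _ _ _ Pr); congr (Pr _).
  by apply/seteqP; split.
move: us => /= /andP[ims us]; rewrite big_cons -{}IHs//.
set j := (i, m).
have sj k : k \in s -> k != j by move=> ks; apply: contraNneq ims;
  rewrite -/j => <-.
have mproj k : measurable_fun setT (fun y : family_space R ('I_P * nat)%type =>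
  y k).
  exact: measurable_proj.
have mt : measurable_fun setT
    (first_update K : family_space R ('I_P * nat)%type -> R).
  by apply: measurable_order_stat => k; exact: mproj.
pose D : set (family_space R ('I_P * nat)%type) :=
  [set y | cylinder s A (restart K y)].
have mD : measurable D.
  rewrite -[X in measurable X]setTI.
  have : measurable_fun setT (restart K :
      family_space R ('I_P * nat)%type -> family_space R ('I_P * nat)%type).
    by apply: measurable_family; apply: measurable_restart.
  by apply => //; exact: measurable_cylinder.
pose B : set (family_space R ('I_P * nat)%type) :=
  [set y | y (i, 0%N) <= first_update K y].
have mB : measurable B.
  rewrite -[X in measurable X]setTI.
  have := measurable_fun_ler (mproj (i, 0%N)) mt.
  by move=> /(_ measurableT [set true]); exact.
(* [memoryless_factor_prob] wants a nonnegative level for every [y] in the event; along [Y] this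
   holds everywhere, so intersecting with [N] changes nothing there. *)
pose N : set (family_space R ('I_P * nat)%type) :=
  [set y | 0 <= first_update K y].
have mN : measurable N.
  rewrite -[X in measurable X]setTI.
  have := measurable_fun_ler (@measurable_cst _ _ _ _ setT (0 : R)) mt.
  by move=> /(_ measurableT [set true]); exact.
have mT (E : set (family_space R ('I_P * nat)%type)) : measurable E ->
    measurable [set w | E (Y w)].
  move=> mE; rewrite -[X in measurable X]setTI.
  exact: (measurable_family mY).
have mr k : measurable_fun setT (fun w => restart K (Y w) k).
  exact: measurable_restart.
have mrA k : measurable [set w | A k (restart K (Y w) k)].
  by rewrite -[X in measurable X]setTI; exact: mr.
(* both parts follow by resampling the coordinate of Y from which
   restart K (Y w) j is read *)
have part_le : Pr ([set w | A j (restart K (Y w) j) /\ D (Y w)] `&` [set w | B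
  (Y w)]) =
    (nu (A j) * Pr ([set w | D (Y w)] `&` [set w | B (Y w)]))%E.
  rewrite -(fresh_factor_prob (a := (i, m.+1)) iidY (measurableI _ _ mD mB))//.
    congr (Pr _); apply/seteqP; split => w /=.
      by move=> [[+ Dw] Bw]; rewrite /restart/= ifT.
    by move=> [? [Dw Bw]]; split => //; split => //; rewrite /restart/= ifT.
  move=> y c [Dy By]; split.
    by move=> k sk; rewrite restart_upd_le ?sj//; exact: Dy.
  by rewrite /B/= first_update_upd// upd_other//; apply/eqP => -[].
have part_gt : Pr ([set w | A j (restart K (Y w) j) /\ D (Y w)] `\` [set w | B
  (Y w)]) =
    (nu (A j) * Pr ([set w | D (Y w)] `\` [set w | B (Y w)]))%E.
  (* Only the running mini-batch of an unfinished worker needs memorylessness; its later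
     mini-batches are untouched. *)
  have [m0|m0] := posnP m.
    have jE : j = (i, 0%N) by rewrite /j m0.
    have -> : [set w | D (Y w)] `\` [set w | B (Y w)] =
        [set w | ((D `\` B) `&` N) (Y w)].
      apply/seteqP; split => w /= => [[Dw Bw]|[]//]; split => //.
      by apply: (order_stat_ge0 KP) => k.
    rewrite -(memoryless_factor_prob (a := j) iidY nuE
      (measurableI _ _ (measurableD mD mB) mN) mt)//.
    - congr (Pr _); apply/seteqP; split => w /=.
        move=> [[+ Dw] Bw]; rewrite /restart/= ifF; last exact/negP.
        rewrite m0 eqxx -jE => Aw; split => //.
        by split=> //; apply: (order_stat_ge0 KP) => k.
      move=> [+ [[Dw Bw] _]] => Aw; split => //; split => //.
      by rewrite /restart/= ifF; [rewrite m0 eqxx -jE|exact/negP].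
    - move=> y [[Dy /negP By] Ny]; rewrite jE ltNge By andbT.
      exact: Ny.
    - move=> y c [[Dy /negP]]; rewrite -ltNge => By Ny tc.
      rewrite jE first_update_upd0//; split => //; split; last first.
        by rewrite /N/= first_update_upd0.
      split; last by rewrite /B/= first_update_upd0// upd_same; apply/negP;
        rewrite -ltNge.
      move=> k sk; have := sj k sk; rewrite jE => kj.
      by rewrite restart_upd0//; exact: Dy.
  rewrite -(fresh_factor_prob (a := j) iidY (measurableD mD mB))//.
    congr (Pr _); apply/seteqP; split => w /=.
      move=> [[+ Dw] Bw]; rewrite /restart/= ifF; last exact/negP.
      by rewrite gtn_eqF.
    move=> [Aw [Dw Bw]]; split => //; split => //.
    by rewrite /restart/= ifF; [rewrite gtn_eqF|exact/negP].
  move=> y c [Dy /negP]; rewrite -ltNge => By; split.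
    by move=> k sk; rewrite restart_upd_gt ?sj//; exact: Dy.
  apply/negP; rewrite /B/= first_update_upd// upd_other -?ltNge//.
  by apply/eqP => -[m_eq]; rewrite -m_eq in m0.
rewrite (_ : [set w | _] = [set w | A j (restart K (Y w) j) /\ D (Y w)]);
  last first.
  apply/seteqP; split => w /=.
    move=> H; split; first by apply: H; rewrite inE eqxx.
    by move=> k sk; apply: H; rewrite inE sk orbT.
  by move=> [Aw Dw] k; rewrite inE => /predU1P[->//|]; exact: Dw.
have mAD : measurable [set w | A j (restart K (Y w) j) /\ D (Y w)].
  by apply: (measurableI _ _ (mrA j)); exact: mT.
have splitB E : measurable E ->
    (Pr E = Pr (E `\` [set w | B (Y w)]) + Pr (E `&` [set w | B (Y w)]))%E.
  by move=> mE; exact: (measureDI Pr mE (mT _ mB)).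
rewrite (splitB _ mAD) (splitB _ (mT _ mD)) part_le part_gt.
by rewrite ge0_muleDr.
Qed.
End iid_restart.

(** * Expected runtimes *)

Section subfamily.
Variables (R : realType) (nu : probability R R).
Context d (T : measurableType d) (Pr : probability T R).

Lemma iid_subfamily (I J : eqType) (h : J -> I) (Y : T -> I -> R) :
  injective h -> iid nu Pr Y -> iid nu Pr (fun w j => Y w (h j)).
Proof.
move=> injh [mY iY]; split=> [j|s A us mA]; first exact: mY.
(* The constraint at [h j] is [A j] by injectivity; outside the range of [h] it is vacuous. *)
pose A' i : set R := [set x | forall j, h j = i -> A j x].
have A'h j : A' (h j) = A j.
  by apply/seteqP; split => x /=; [apply|move=> Ax k /injh ->].
have mA' i : measurable (A' i).
  have [[j <-]|nj] := pselect (exists j, h j = i); first by rewrite A'h.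
  rewrite (_ : A' i = setT)//; apply/seteqP; split => // x _ j hj.
  by case: nj; exists j.
rewrite (_ : [set w | _] = [set w | cylinder (map h s) A' (Y w)]).
  rewrite iY ?map_inj_uniq// big_map.
  by apply: eq_bigr => j _; rewrite A'h.
apply/seteqP; split => w /= H i.
  by move=> /mapP[j js ->]; rewrite A'h; exact: H.
by move=> js; rewrite -A'h; apply: H; exact: map_f.
Qed.

(** [nu] lives on the nonnegative reals, where the absolute value is the identity; this provides a
    version that is nonnegative at every point. *)
Lemma iid_norm (I : eqType) (Y : T -> I -> R) : nu `]-oo, 0[%classic = 0%E ->
  iid nu Pr Y -> iid nu Pr (fun w i => `|Y w i|).
Proof.
move=> nu0 [mY iY]; split=> [i|s A us mA]; first exact: measurableT_comp.
have mN B : measurable B -> measurable ((@Num.norm R R) @^-1` B).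
  by move=> mB; rewrite -[X in measurable X]setTI;
    exact: (@normr_measurable R setT).
have nuN B : measurable B -> nu ((@Num.norm R R) @^-1` B) = nu B.
  have pos C : measurable C -> nu C = nu (C `&` `[0, +oo[).
    move=> mC; transitivity (nu (C `\` `[0%R, +oo[%classic) + nu (C `&` `[0%R,
      +oo[%classic))%E.
      by apply: (measureDI nu).
    rewrite [X in (X + _)%E](_ : _ = 0%E) ?add0e//.
    apply: (@subset_measure0 _ _ _ nu _ `]-oo, 0[%classic) => //.
      exact: measurableD.
    by move=> x [_]; rewrite -[~ _]/((~` `[0, +oo[%classic) x) setCitvr.
  move=> mB; rewrite (pos _ mB) (pos _ (mN _ mB)).
  congr (nu _); apply/seteqP; split => x; rewrite /= in_itv/= andbT => -[+ x0];
    by rewrite ger0_norm.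
rewrite (_ : [set w | _] =
  [set w | cylinder s (fun i => (@Num.norm R R) @^-1` A i) (Y w)])//.
rewrite iY//; last by move=> i; exact: mN.
by apply: eq_bigr => i _; rewrite nuN.
Qed.
End subfamily.

Section expectations.
Variables (R : realType) (mu : R) (nu : probability R R).
Hypothesis mu_gt0 : 0 < mu.
Hypothesis nuE : forall B, measurable B -> nu B = exponential_prob mu B.
Context d (T : measurableType d) (Pr : probability T R).

(** Once [Y w b] is frozen, a tie confines the resampled coordinate [a] to a single point, which is
    [nu]-null. *)
Lemma ae_distinct (I : eqType) (Y : T -> I -> R) a b : iid nu Pr Y ->
  a != b -> {ae Pr, forall w, Y w a != Y w b}.
Proof.
move=> iidY ab; have mY := iidY.1.
pose E : set (family_space R I) := [set y | y a == y b].
have mE : measurable E.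
  rewrite -[X in measurable X]setTI.
  have := measurable_fun_eqr (@measurable_proj R I a) (@measurable_proj R I b).
  by move=> /(_ measurableT [set true]); exact.
have mEY : measurable [set w | E (Y w)].
  by rewrite -[X in measurable X]setTI; exact: (measurable_family mY).
have E0 : Pr [set w | E (Y w)] = 0%E.
  transitivity (\int[Pr]_w (\1_E (Y w))%:E)%E.
    rewrite (eq_integral (fun w => (\1_[set w | E (Y w)] w)%:E))//.
    by rewrite integral_indic ?setIT.
  rewrite (iid_factor (a := a) (E := E) (H := 0%E) iidY
    (g := fun y => (\1_E y)%:E))//.
  - by rewrite mul0e.
  - exact/measurable_EFinP/measurable_indic.
  move=> y; rewrite mul0e.
  have Ey x : E (upd y a x) <-> x = y b.
    have yb : upd y a x b = y b by apply: upd_other; rewrite eq_sym.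
    by rewrite /E/= upd_same yb; split => /eqP.
  rewrite (eq_integral (fun x => (\1_[set y b] x)%:E)).
    rewrite integral_indic ?setIT//; exact: (exponential_law_set1 nuE).
  move=> x _; rewrite !indicE; congr ((nat_of_bool _)%:R%:E).
  by apply/idP/idP; rewrite !inE; apply Ey.
exists [set w | E (Y w)]; split => // w /= /negP.
by rewrite negbK.
Qed.

Lemma ae_neq0 (I : eqType) (Y : T -> I -> R) a : iid nu Pr Y ->
  {ae Pr, forall w, Y w a != 0}.
Proof.
move=> iidY; exists [set w | cylinder [:: a] (fun=> [set 0]) (Y w)].
have m0 : measurable ([set 0] : set R) by [].
split.
- rewrite -[X in measurable X]setTI.
  by apply: (measurable_family iidY.1) => //; exact: measurable_cylinder.
- by rewrite iidY.2// big_seq1 (exponential_law_set1 nuE).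
by move=> w /= /negP; rewrite negbK => /eqP Ya i; rewrite inE => /eqP ->.
Qed.

Section workers.
Variable P : nat.

Lemma ae_generic (Y : T -> 'I_P -> R) : iid nu Pr Y ->
  (forall w i, 0 <= Y w i) ->
  {ae Pr, forall w, injective (Y w) /\ forall i, 0 < Y w i}.
Proof.
move=> iidY Y0.
have : {ae Pr, forall w, forall ij : 'I_P * 'I_P,
    (ij.1 != ij.2 -> Y w ij.1 != Y w ij.2) /\ Y w ij.1 != 0}.
  apply: filter_forall => -[i j] /=.
  have Dij : {ae Pr, forall w, i != j -> Y w i != Y w j}.
    have [->|ij] := eqVneq i j; first by apply: aeW.
    by apply: filterS (ae_distinct iidY ij) => w.
  by apply: filterS2 Dij (ae_neq0 i iidY) => w; split.
apply: filterS => w H; split.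
  move=> i j Yij; apply/eqP; apply/negPn/negP => ij.
  by have [/(_ ij)] := H (i, j); rewrite Yij eqxx.
by move=> i; rewrite lt_neqAle Y0 andbT eq_sym; have [] := H (i, i).
Qed.

(** Given that worker [i] exceeds the level, its excess has mean [mu^-1] by memorylessness; almost
    surely exactly [P - k] workers exceed it. *)
Lemma expectation_excess (Y : T -> 'I_P -> R) k : iid nu Pr Y ->
  (forall w i, 0 <= Y w i) -> (k <= P)%N ->
  (\int[Pr]_w (\sum_(i < P) Num.max (Y w i - order_stat0 k (Y w)) 0)%R%:E =
   ((P - k)%:R / mu)%:E)%E.
Proof.
move=> iidY Y0 kP; have mY := iidY.1.
have mT0 : measurable_fun setT (fun w => order_stat0 k (Y w)).
  exact: (measurable_order_stat0 k mY).
have mt : measurable_fun setT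
    (order_stat0 k : family_space R 'I_P -> R).
  exact: (measurable_order_stat0 k (@measurable_proj R 'I_P)).
pose E i : set (family_space R 'I_P) :=
  [set y | 0 <= order_stat0 k y < y i].
have mE i : measurable (E i).
  rewrite -[X in measurable X]setTI.
  have := measurable_and (measurable_fun_ler (@measurable_cst _ _ _ _ setT (0 :
    R)) mt)
    (measurable_fun_ltr mt (@measurable_proj R 'I_P i)).
  by move=> /(_ measurableT [set true]); exact.
have mEY i : measurable [set w | E i (Y w)].
  by rewrite -[X in measurable X]setTI; exact: (measurable_family mY).
have EY w i : (Y w \in E i) = (order_stat0 k (Y w) < Y w i).
  by apply/idP/idP; rewrite inE /E/= order_stat0_ge0.
have excessE i : (\int[Pr]_w (Num.max (Y w i - order_stat0 k (Y w)) 0)%:E =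
    mu^-1%:E * Pr [set w | E i (Y w)])%E.
  rewrite -(exponential_law_mean mu_gt0 nuE).
  rewrite -(memoryless_factor iidY nuE (mE i) mt (a := i)
    (h := fun x => `|x|%:E))//.
  - apply: eq_integral => w _; rewrite indicE EY.
    case: ltP => [lt|ge]; last by rewrite mule0 max_r// subr_le0.
    by rewrite mule1 max_l ?gtr0_norm ?subr_gt0// subr_ge0 ltW.
  - exact/measurable_EFinP.
  - move=> y c /andP[t0 ty] tc.
    have tE : order_stat0 k (upd y i c) = order_stat0 k y.
      apply: (order_stat0_move (i := i)) => //; last by rewrite upd_same.
      by move=> j ji; rewrite upd_other.
    by rewrite /E/= tE upd_same t0.
under eq_integral do rewrite -sumEFin.
rewrite ge0_integral_sum//; last 2 first.
- move=> i; apply/measurable_EFinP; apply: measurable_maxr => //.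
  exact: measurable_funB.
- by move=> i w _; rewrite lee_fin le_max lexx orbT.
under eq_bigr do rewrite excessE.
transitivity (mu^-1%:E * \sum_(i < P) Pr [set w | E i (Y w)])%E.
  by rewrite ge0_sume_distrr.
rewrite mulrC EFinM; congr (_ * _)%E.
transitivity (\int[Pr]_w (\sum_(i < P) (\1_(E i) (Y w))%:E))%E.
  rewrite ge0_integral_sum//.
  - apply: eq_bigr => i _.
    rewrite [RHS](eq_integral (fun w => (\1_[set w | E i (Y w)] w)%:E))//.
    by rewrite integral_indic ?setIT.
  - move=> i; apply/measurable_EFinP.
    exact: (@measurable_indic _ T R setT [set w | E i (Y w)] (mEY i)).
rewrite (ae_eq_integral (cst (P - k)%:R%:E))//.
- transitivity ((P - k)%:R%:E * Pr setT)%E; first exact: integral_cst.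
  by rewrite probability_setT mule1.
- apply: emeasurable_sum => i; apply/measurable_EFinP.
  exact: (@measurable_indic _ T R setT [set w | E i (Y w)] (mEY i)).
- apply: filterS (ae_generic iidY Y0) => w [injY Ypos] _ /=.
  rewrite sumEFin; congr (_%:E); rewrite -(order_stat0_lt_count kP injY Ypos).
  by rewrite natr_sum; apply: eq_bigr => i _; rewrite indicE EY.
Qed.

Lemma expectation_order_stat0 (Y : T -> 'I_P -> R) k : iid nu Pr Y ->
  (forall w i, 0 <= Y w i) -> (k <= P)%N ->
  (\int[Pr]_w (order_stat0 k (Y w))%:E =
   (\sum_((P - k).+1 <= i < P.+1) (i%:R * mu)^-1)%R%:E)%E.
Proof.
move=> iidY Y0; have mY := iidY.1.
have mT0 j : measurable_fun setT (fun w => order_stat0 j (Y w)).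
  exact: (measurable_order_stat0 j mY).
elim: k => [_|k IHk kP]; first by rewrite subn0 big_geq// integral0.
have Pk0 : (0 < (P - k)%:R :> R) by rewrite ltr0n subn_gt0.
pose gap w := order_stat0 k.+1 (Y w) - order_stat0 k (Y w).
have mgap : measurable_fun setT gap by exact: measurable_funB.
have gap0 w : 0 <= gap w by rewrite subr_ge0 order_stat0_leS.
have gapE : (\int[Pr]_w (gap w)%:E = (((P - k)%:R * mu)^-1)%:E)%E.
  have := expectation_excess iidY Y0 (ltnW kP).
  under eq_integral do rewrite (excess_order_stat0 kP (Y0 _)) EFinD EFinM.
  rewrite ge0_integralD//; first last.
  - by apply: measurable_funeM; exact/measurable_EFinP.
  - by move=> w _; rewrite mule_ge0// lee_fin// gap0.
  - apply/measurable_EFinP; apply: measurable_sum => i.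
    by apply: measurable_maxr => //; exact: measurable_funB.
  - by move=> w _; rewrite lee_fin sumr_ge0// => i _; rewrite le_max lexx orbT.
  rewrite (expectation_excess iidY Y0 kP).
  rewrite ge0_integralZl//; last 2 first.
  - exact/measurable_EFinP.
  - by move=> w _; rewrite lee_fin gap0.
  rewrite -/gap.
  (* The identity can be solved for this integral only if it is finite: [-oo] contradicts
     nonnegativity, and [+oo] the finite total excess. *)
  have : (0 <= \int[Pr]_w (gap w)%:E)%E.
    by apply: integral_ge0 => w _; rewrite lee_fin.
  case: (integral _ _ _) => [g|//|//] _; last first.
    by rewrite gt0_muley ?lte_fin// addey.
  rewrite -EFinM -EFinD => -[gE]; congr (_%:E).
  apply: (mulfI (lt0r_neq0 Pk0)); rewrite invfM mulrA divff ?lt0r_neq0// mul1r.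
  have PkS : (P - k)%:R = (P - k.+1)%:R + 1 :> R by rewrite -(subnSK kP) natr1.
  by move: gE; rewrite [in RHS]PkS mulrDl mul1r => /addrI.
rewrite (eq_integral (fun w => (order_stat0 k (Y w))%:E + (gap w)%:E)%E);
  last first.
  by move=> w _; rewrite -EFinD addrC subrK.
rewrite ge0_integralD//; last 4 first.
- by move=> w _; rewrite lee_fin order_stat0_ge0// ltnW.
- exact/measurable_EFinP.
- by move=> w _; rewrite lee_fin.
- exact/measurable_EFinP.
rewrite (IHk (ltnW kP)) gapE (subnSK kP).
have PkP : (P - k < P.+1)%N by rewrite ltnS leq_subr.
by rewrite [in RHS](big_ltn PkP) EFinD addeC.
Qed.

Lemma expectation_order_stat (Y : T -> 'I_P -> R) k : iid nu Pr Y ->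
  (forall w i, 0 <= Y w i) -> (0 < k <= P)%N ->
  (\int[Pr]_w (order_stat k (Y w))%:E =
   (\sum_((P - k).+1 <= i < P.+1) (i%:R * mu)^-1)%R%:E)%E.
Proof.
move=> iidY Y0 /andP[k0 kP]; rewrite -(expectation_order_stat0 iidY Y0 kP).
by case: k k0 kP.
Qed.

(** The induction is over all families at once, since each step replaces [Y] by its restart. *)
Lemma expectation_K_async (Y : T -> 'I_P * nat -> R) k n : iid nu Pr Y ->
  (forall w j, 0 <= Y w j) -> (0 < k <= P)%N ->
  (\int[Pr]_w (order_stat k
     (fun i => (K_async_state k (fun i m => Y w (i, m)) n i).1))%:E =
   (\sum_((P - k).+1 <= i < P.+1) (i%:R * mu)^-1)%R%:E)%E.
Proof.
move=> iidY Y0 kP; elim: n Y iidY Y0 => [|n IHn] Y iidY Y0.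
  apply: (@expectation_order_stat (fun w i => Y w (i, 0%N))) => //.
  by apply: (@iid_subfamily _ _ _ _ _ _ _ (fun i => (i, 0%N))) => // i j [].
under eq_integral do rewrite K_async_runtime_restart.
apply: (IHn (fun w => restart k (Y w))); first exact: (iid_restart kP nuE).
by move=> w j; exact: restart_ge0.
Qed.

Lemma expectation_finish_time (Y : T -> 'I_P * nat -> R) n : iid nu Pr Y ->
  (forall w j, 0 <= Y w j) -> (0 < P)%N ->
  (\int[Pr]_w (finish_time (fun i m => Y w (i, m)) n)%:E =
   (n%:R / (P%:R * mu))%:E)%E.
Proof.
move=> iidY Y0 P0; elim: n Y iidY Y0 => [|n IHn] Y iidY Y0.
  rewrite mul0r; apply: integral0_eq => w _; congr (_%:E).
  rewrite /finish_time /kth_smallest nth_default// size_sort.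
  by elim: (enum _).
have mY := iidY.1.
have kP : (0 < 1 <= P)%N by [].
have iid0 : iid nu Pr (fun w i => Y w (i, 0%N)).
  by apply: (@iid_subfamily _ _ _ _ _ _ _ (fun i => (i, 0%N))) => // i j [].
have m1 : measurable_fun setT (fun w => first_update 1 (Y w)).
  exact: (measurable_order_stat 1 (f := fun i w => Y w (i, 0%N))).
have mr : forall j, measurable_fun setT (fun w => restart 1 (Y w) j).
  exact: measurable_restart.
have mf : measurable_fun setT
    (fun w => finish_time (fun i m => restart 1 (Y w) (i, m)) n).
  exact: (measurable_finish_time n (f := fun i m w => restart 1 (Y w) (i, m))).
(* The decomposition needs distinct first mini-batch times, hence holds almost everywhere. *)
rewrite (ae_eq_integral (fun w => (first_update 1 (Y w))%:E +
    (finish_time (fun i m => restart 1 (Y w) (i, m)) n)%:E)%E)//; last 3 first.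
- apply/measurable_EFinP.
  exact: (measurable_finish_time n.+1 (f := fun i m w => Y w (i, m))).
- by apply: emeasurable_funD; exact/measurable_EFinP.
- apply: filterS (ae_generic iid0 (fun w i => Y0 w (i, 0%N))) => w [injY _] _
  /=.
  by rewrite finish_time_restart.
rewrite ge0_integralD//; last 4 first.
- by move=> w _; rewrite lee_fin; apply: (order_stat_ge0 kP) => i; exact: Y0.
- exact/measurable_EFinP.
- move=> w _; rewrite lee_fin; apply: finish_time_ge0 => i m.
  by apply: restart_ge0 => j; exact: Y0.
- exact/measurable_EFinP.
rewrite (IHn (fun w => restart 1 (Y w))); last 2 first.
- exact: (iid_restart kP nuE).
- by move=> w j; exact: restart_ge0.
rewrite (expectation_order_stat iid0)// -EFinD; congr (_%:E).
rewrite subn1 prednK// big_nat1 -[n.+1]add1n natrD mulrDl; congr (_ + _).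
by rewrite mul1r.
Qed.
End workers.
End expectations.

(** * Harmonic numbers and logarithms *)

Section harmonic.
Variable R : realType.

(** The difference of the two sides has derivative [(expR x - 1) ^+ 2 / expR x]. At [s = ln u] the
    bound reads [ln u <= (u - u^-1) / 2]. *)
Lemma expR_sinh_ge (s : R) : 0 <= s -> s * 2 <= expR s - expR (- s).
Proof.
move=> s0; pose f (x : R) : R := expR x - expR (- x) - x * 2.
have fD (x : R^o) : is_derive x 1 (f : R^o -> R^o) (expR x + expR (- x) - 2).
  rewrite /f; apply: is_derive_eq.
  by rewrite mulrN1 opprK scaler0 add0r -[2%:A]/(2 * 1) mulr1.
have : f 0 <= f s.
  apply: (@ger0_derive1_ndecry R f 0) => //.
  - move=> x _; rewrite derive1E derive_val expRN; have ex := expR_gt0 x.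
    rewrite (_ : _ - _ = (expR x - 1) ^+ 2 / expR x).
      by rewrite divr_ge0 ?sqr_ge0 ?ltW.
    by field; rewrite gt_eqF.
  - by apply: derivable_within_continuous => x _; exact: ex_derive.
by rewrite /f oppr0 subrr mul0r subr0 subr_ge0.
Qed.

(** With [u = j.+1%:R / j%:R], the lower bound is [ln (1 + x) <= x] at [x = - j.+1%:R^-1], and the
    upper bound is exactly [(u - u^-1) / 2]. *)
Lemma ln_succ_bounds (j : nat) : (0 < j)%N ->
  j.+1%:R^-1 <= ln (j.+1%:R / j%:R) :> R /\
  ln (j.+1%:R / j%:R) <= (1 + (2 * j%:R)^-1) / j.+1%:R :> R.
Proof.
move=> j0; have J0 : 0 < j%:R :> R by rewrite ltr0n.
have J1 : 0 < j.+1%:R :> R by rewrite ltr0n.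
have u0 : 0 < j.+1%:R / j%:R :> R by rewrite divr_gt0.
have jS : j.+1%:R = j%:R + 1 :> R by rewrite natr1.
split.
  have : - j.+1%:R^-1 > -1 :> R.
    by rewrite ltrN2 invf_lt1// -[1]/(1%:R) ltr_nat.
  move=> /le_ln1Dx; rewrite (_ : 1 - _ = (j.+1%:R / j%:R)^-1) ?lnV ?posrE//.
    by rewrite lerN2.
  by rewrite jS; field; lra.
have s0 : 0 <= ln (j.+1%:R / j%:R) :> R.
  by rewrite ln_ge0// ler_pdivlMr// mul1r ler_nat.
have := expR_sinh_ge s0; rewrite expRN lnK ?posrE// -ler_pdivlMr//.
move=> /le_trans; apply.
by rewrite le_eqVlt; apply/orP; left; apply/eqP; rewrite jS; field; lra.
Qed.

(* The upper bound is the trapezoidal rule for the integral of 1 / x, which is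
   convex. *)
Lemma harmonic_diff_bounds (Q P : nat) : (0 < Q <= P)%N ->
  \sum_(Q.+1 <= i < P.+1) i%:R^-1 <= ln (P%:R / Q%:R) :> R /\
  ln (P%:R / Q%:R) <=
    (1 + (2 * Q%:R)^-1) * \sum_(Q.+1 <= i < P.+1) i%:R^-1 :> R.
Proof.
move=> /andP[Q0 /subnKC <-]; elim: (P - Q)%N => [|n [IHl IHu]].
  by rewrite addn0 big_geq// mulr0 divff ?ln1// pnatr_eq0 -lt0n.
have QnQ : (0 < Q + n)%N by rewrite addn_gt0 Q0.
rewrite addnS big_nat_recr/=; last by rewrite ltnS leq_addr.
have -> : ln ((Q + n).+1%:R / Q%:R) =
    ln ((Q + n)%:R / Q%:R) + ln ((Q + n).+1%:R / (Q + n)%:R) :> R.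
  rewrite -lnM ?posrE ?divr_gt0 ?ltr0n//; congr ln.
  by rewrite [RHS]mulrC mulrA divfK// pnatr_eq0 -lt0n.
have [l u] := ln_succ_bounds QnQ.
split; first exact: lerD.
(* The correction factor decreases in [j], so its value at [Q] dominates the one at [Q + n]. *)
rewrite mulrDr lerD// (le_trans u)// ler_pM2r ?invr_gt0 ?ltr0n//.
rewrite lerD2l lef_pV2 ?posrE ?mulr_gt0 ?ltr0n//.
by rewrite ler_pM2l// ler_nat leq_addr.
Qed.
End harmonic.

(** * Expected runtimes of the four variants *)

Section main.
Variables (R : realType) (mu : R) (nu : probability R R).
Hypothesis mu_gt0 : 0 < mu.
Hypothesis nuE : forall B, measurable B -> nu B = exponential_prob mu B.
Context d (T : measurableType d) (Pr : probability T R).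

Lemma iid_exponential_iid (I : eqType) (X : I -> {RV Pr >-> R}) :
  iid_exponential mu X -> iid nu Pr (fun w i => X i w).
Proof.
move=> [indX expX]; split=> [i|s A us mA]; first exact: measurable_funPT.
transitivity (\prod_(i <- s) Pr (X i @^-1` A i))%E; first exact: indX.
by apply: eq_bigr => i _; rewrite nuE//; exact: expX.
Qed.

(** Only the law matters, so the expectation may be computed along the absolute values, where the
    pointwise nonnegativity assumed above holds. *)
Lemma expectation_norm (I : eqType) (Y : T -> I -> R)
    (F : family_space R I -> R) : iid nu Pr Y -> measurable_fun setT F ->
  ('E_Pr[fun w => F (Y w)] = \int[Pr]_w (F (fun i => `|Y w i|))%:E)%E.
Proof.
move=> iidY mF; rewrite unlock.
apply: (iid_transfer (F := fun y => (F y)%:E) iidY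
  (iid_norm (exponential_law_lt0 nuE) iidY)).
exact/measurable_EFinP.
Qed.

Let norm_iid (I : eqType) (Y : T -> I -> R) : iid nu Pr Y ->
  iid nu Pr (fun w i => `|Y w i|).
Proof. exact: iid_norm (exponential_law_lt0 nuE). Qed.

Lemma expectation_exponential (X0 : {RV Pr >-> R}) :
  exponential_rv mu X0 -> ('E_Pr[X0] = mu^-1%:E)%E.
Proof.
move=> expX0; have iid0 : iid nu Pr (fun w (_ : unit) => X0 w).
  split=> [_|s A us mA]; first exact: measurable_funPT.
  case: s us => [_|[] [|[] s]//= _].
    rewrite big_nil -[RHS](@probability_setT _ _ _ Pr); congr (Pr _).
    by apply/seteqP; split.
  rewrite big_seq1 nuE// -expX0//; congr (Pr _).
  by apply/seteqP; split => w /= => [/(_ tt)|? []]//; apply; rewrite inE.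
rewrite (expectation_norm (F := fun y => y tt) iid0);
  last exact: measurable_proj.
rewrite -(exponential_law_mean mu_gt0 nuE).
rewrite -(ge0_integral_distribution X0 (f := fun x => `|x|%:E)).
- apply: eq_measure_integral => A mA _.
  by rewrite [RHS]nuE//; exact: expX0.
- exact/measurable_EFinP.
- by move=> x; rewrite lee_fin.
Qed.

Variables (P K : nat).
Hypothesis KP : (0 < K <= P)%N.

Let gapsum : R := \sum_((P - K).+1 <= i < P.+1) (i%:R * mu)^-1.

Lemma expectation_order_stat_iid (Y : T -> 'I_P -> R) : iid nu Pr Y ->
  ('E_Pr[fun w => order_stat K (Y w)] = gapsum%:E)%E.
Proof.
move=> iidY; rewrite (expectation_norm (F := order_stat K) iidY).
  exact: (expectation_order_stat mu_gt0 nuE (norm_iid iidY)).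
exact: (measurable_order_stat K (@measurable_proj R 'I_P)).
Qed.

Variable Z : nat * 'I_P * nat -> {RV Pr >-> R}.
Hypothesis iidZ : iid_exponential mu Z.

Let iid_round r : iid nu Pr (fun w (j : 'I_P * nat) => Z (r, j.1, j.2) w).
Proof.
apply: (iid_subfamily (h := fun j : 'I_P * nat => (r, j.1, j.2)))
  (iid_exponential_iid iidZ).
by move=> [i m] [i' m'] [-> ->].
Qed.

Lemma expectation_K_sync n :
  ('E_Pr[along (K_sync_runtime K) Z n] = gapsum%:E)%E.
Proof.
apply: (@expectation_order_stat_iid (fun w i => Z (n, i, 0%N) w)).
by apply: (iid_subfamily (h := fun i => (i, 0%N))) (iid_round n) => i j [].
Qed.

Lemma expectation_K_batch_sync n :
  ('E_Pr[along (K_batch_sync_runtime K) Z n] = (K%:R / (P%:R * mu))%:E)%E.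
Proof.
have P0 : (0 < P)%N by case/andP: KP => /leq_trans; apply.
rewrite [LHS](expectation_norm
  (F := fun y => finish_time (fun i m => y (i, m)) K) (iid_round n)).
  exact: (expectation_finish_time mu_gt0 nuE K (norm_iid (iid_round n))).
exact: (measurable_finish_time K (fun i m => @measurable_proj R _ (i, m))).
Qed.

Lemma expectation_K_async_runtime n :
  ('E_Pr[along (K_async_runtime K) Z n] = gapsum%:E)%E.
Proof.
rewrite [LHS](expectation_norm (F := fun y => order_stat K
  (fun i => (K_async_state K (fun i m => y (i, m)) n i).1)) (iid_round 0)).
  exact: (expectation_K_async mu_gt0 nuE n (norm_iid (iid_round 0))).
exact: (measurable_K_async_runtime K n (@measurable_proj R _)).
Qed.

Lemma expectation_K_batch_async n :
  ('E_Pr[along (K_batch_async_runtime K) Z n] = (K%:R / (P%:R * mu))%:E)%E.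
Proof.
have P0 : (0 < P)%N by case/andP: KP => /leq_trans; apply.
pose F N (y : 'I_P * nat -> R) := finish_time (fun i m => y (i, m)) N.
have mF N : measurable_fun setT (F N : family_space R ('I_P * nat)%type -> R).
  exact: (measurable_finish_time N (fun i m => @measurable_proj R _ (i, m))).
pose Y w (j : 'I_P * nat) := `|Z (0%N, j.1, j.2) w|.
have iidY : iid nu Pr Y := norm_iid (iid_round 0).
have Y0 w j : 0 <= Y w j by exact: normr_ge0.
have EF N : (\int[Pr]_w (F N (Y w))%:E = (N%:R / (P%:R * mu))%:E)%E.
  exact: (expectation_finish_time mu_gt0 nuE N iidY Y0 P0).
(* Both finishing times must be integrable for the expectation of their difference to split. *)
have intF N : Pr.-integrable setT (EFin \o (fun w => F N (Y w))).
  apply/integrableP; split.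
    apply/measurable_EFinP.
    exact: (measurableT_comp (mF N) (measurable_family iidY.1)).
  rewrite (eq_integral (fun w => (F N (Y w))%:E)); first by rewrite EF ltry.
  move=> w _ /=; rewrite ger0_norm//.
  by apply: finish_time_ge0 => i m; exact: normr_ge0.
rewrite [LHS](expectation_norm (F := fun y => F (n.+1 * K)%N y - F (n * K)%N y)
  (iid_round 0)); last exact: measurable_funB.
rewrite -/Y; under eq_integral do rewrite EFinB.
rewrite integralB_EFin// !EF -EFinB -mulrBl; congr (_ / _)%:E.
by rewrite mulSn natrD addrK.
Qed.
End main.

Local Open Scope ereal_scope.

Theorem theorem2 (R : realType) (d : measure_display) (T : measurableType d)
    (Pr : probability T R) (P K : nat) (mu : R)
    (X0 : {RV Pr >-> R}) (X : 'I_P -> {RV Pr >-> R})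
    (Z : nat * 'I_P * nat -> {RV Pr >-> R}) :
  (0 < K <= P)%N -> (0 < mu)%R ->
  exponential_rv mu X0 ->
  iid_exponential mu X ->
  iid_exponential mu Z ->
  let EXKP := 'E_Pr[fun w => order_stat K (fun i => X i w)] in
  let ratio := (P%:R%:E * EXKP) / (K%:R%:E * 'E_Pr[X0]) in
  let ET_sync n := 'E_Pr[along (K_sync_runtime K) Z n] in
  let ET_batch_sync n := 'E_Pr[along (K_batch_sync_runtime K) Z n] in
  let ET_async n := 'E_Pr[along (K_async_runtime K) Z n] in
  let ET_batch_async n := 'E_Pr[along (K_batch_async_runtime K) Z n] in
  [/\ forall n m, ET_sync n / ET_batch_sync m = ratio,
      cvgn ET_batch_async /\
        (forall n, ET_async n / limn ET_batch_async = ratio),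
      EXKP = (\sum_((P - K).+1 <= i < P.+1) (i%:R * mu)^-1)%R%:E
    & (K < P)%N ->
        ratio <= (P%:R * ln (P%:R / (P - K)%:R) / K%:R)%R%:E
              <= (1 + (2 * (P - K)%:R)^-1)%R%:E * ratio].
Proof.
move=> KP mu0 expX0 iidX iidZ EXKP ratio ET_sync ET_batch_sync ET_async
  ET_batch_async.
have /andP[K0 leKP] := KP.
have [K0R P0R] : (0 < K%:R :> R)%R /\ (0 < P%:R :> R)%R.
  by rewrite !ltr0n K0 (leq_trans K0).
pose nu : probability R R := distribution Pr X0.
have nuE B : measurable B -> nu B = exponential_prob mu B by exact: expX0.
set h : R := (\sum_((P - K).+1 <= i < P.+1) (i%:R * mu)^-1)%R.
have EX : EXKP = h%:E.
  exact: (expectation_order_stat_iid mu0 nuE KP (iid_exponential_iid nuE iidX)).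
pose r : R := (P%:R * h * mu / K%:R)%R.
have ratioE : ratio = r%:E.
  rewrite /ratio EX (expectation_exponential mu0 nuE expX0) -!EFinM.
  rewrite inver gt_eqF ?divr_gt0// -EFinM; congr (_%:E).
  by rewrite /r invf_div mulrA.
have quotE : h%:E / (K%:R / (P%:R * mu))%:E = ratio.
  rewrite ratioE inver gt_eqF ?divr_gt0 ?mulr_gt0// -EFinM; congr (_%:E).
  by rewrite /r invf_div mulrA; congr (_ / _)%R; ring.
(* The expected runtime is the same in every iteration, so the limit is that of a constant
   sequence. *)
have asyncE : ET_batch_async = cst (K%:R / (P%:R * mu))%:E.
  by apply/funext => n; exact: (expectation_K_batch_async mu0 nuE KP iidZ).
split.
- move=> n m; rewrite /ET_sync /ET_batch_sync.
  by rewrite (expectation_K_sync mu0 nuE KP iidZ)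
    (expectation_K_batch_sync mu0 nuE KP iidZ).
- rewrite asyncE; split; first exact: is_cvg_cst.
  by move=> n; rewrite lim_cst// /ET_async
    (expectation_K_async_runtime mu0 nuE KP iidZ).
- exact: EX.
move=> ltKP; have QP : (0 < P - K <= P)%N by rewrite subn_gt0 ltKP leq_subr.
have [lo up] := harmonic_diff_bounds R QP.
set H : R := (\sum_((P - K).+1 <= i < P.+1) i%:R^-1)%R in lo up.
(* The rate cancels, leaving the harmonic difference [H] between [P - K] and [P], to which the
   logarithmic bounds apply. *)
have rE : r = (P%:R * H / K%:R)%R.
  rewrite /r (_ : h = H / mu)%R; first by rewrite mulrA divfK// gt_eqF.
  by rewrite /h /H mulr_suml; apply: eq_bigr => i _; rewrite invfM.
rewrite ratioE -EFinM !lee_fin rE; apply/andP; split.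
  by rewrite ler_pM2r ?invr_gt0// ler_pM2l.
by rewrite mulrA ler_pM2r ?invr_gt0// mulrCA ler_pM2l.
Qed.
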